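(* Let $F$ be a finitely generated free group of rank at least two. The kernel of $d^F : \mathrm{Comm}(F) \to \mathbb{Z}^{(\mathcal{FS})}$ is the subgroup $\mathrm{AComm}(F)$ of $\mathrm{Comm}(F)$.
   Context: A virtual isomorphism of a group $\Gamma$ is an isomorphism $\varphi: A \to B$ between finite index subgroups $A,B$ of $\Gamma$. Two virtual isomorphisms are equivalent if they agree on a common finite index subgroup of their domains; $[\varphi]$ denotes the equivalence class. The composition of $\varphi: A\to B$ followed by $\psi: C \to D$ is the isomorphism $\varphi^{-1}(B\cap C) \to \psi(B\cap C)$, $x \mapsto \psi(\varphi(x))$. Equivalence classes form a group under composition, the abstract commensurator $\mathrm{Comm}(\Gamma)$. For a finite index subgroup $A$ of $\Gamma$, every automorphism of $A$ is a virtual isomorphism of $\Gamma$, giving a homomorphism $a_A : \mathrm{Aut}(A) \to \mathrm{Comm}(\Gamma)$. $\mathrm{AComm}(\Gamma)$ is the subgroup of $\mathrm{Comm}(\Gamma)$ generated by all $a_A(\mathrm{Aut}(A))$, where $A$ ranges over the finite index subgroups of $\Gamma$. A virtual isomorphism $\varphi : A\to B$ is $\Gamma$-subnormal if both $A$ and $B$ are subnormal in $\Gamma$; every element of $\mathrm{Comm}(\Gamma)$ has a $\Gamma$-subnormal representative. $\mathcal{FS}$ is the collection of isomorphism classes of finite simple groups (including cyclic groups of prime order). $\mathbb{Z}^{(\mathcal{FS})}$ is the free abelian group with basis $\mathcal{FS}$ (finitely supported functions $\mathcal{FS}\to\mathbb{Z}$), and $\delta_S$ is the Dirac function at $S$.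 If $A$ is a finite index subnormal subgroup of $\Gamma$, a composition series going from $A$ to $\Gamma$ is a finite series $(A_\ell,\dots,A_0)$ with $A_\ell = A$, $A_0=\Gamma$, each $A_{i+1}$ normal in $A_i$ and $A_i/A_{i+1}$ finite simple. For $S \in \mathcal{FS}$, $n_S^\Gamma(A)$ is the number of indices $i$ with $A_i/A_{i+1} \simeq S$ (independent of the series). The map $d^\Gamma : \mathrm{Comm}(\Gamma)\to \mathbb{Z}^{(\mathcal{FS})}$ is the (well-defined) group homomorphism $d^\Gamma(c) = \sum_{S} (n_S^\Gamma(B)-n_S^\Gamma(A))\delta_S$, where $\varphi : A\to B$ is any $\Gamma$-subnormal representative of $c$. *)

(* Defs.v *)
(* Groups are the (possibly infinite) groups [groupType] of mathcomp.boot.monoid;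
   sets, cardinality and choice come from mathcomp.classical, the free abelian
   group {freeg K} from multinomials. *)
From HB Require Import structures.
From mathcomp Require Import all_boot all_order all_algebra all_fingroup gseries.
From mathcomp Require Import generic_quotient freeg.
From mathcomp Require Import mathcomp_extra boolp classical_sets functions.
From mathcomp Require Import cardinality fsbigop.

Set Implicit Arguments.
Unset Strict Implicit.
Unset Printing Implicit Defensive.

Import GRing.Theory.
Local Open Scope quotient_scope.
Local Open Scope classical_set_scope.
Local Open Scope group_scope.

Definition group_iso (G H : groupType) : Prop :=
  exists f : {multiplicative G -> H}, bijective f.

Definition free_basis (F : groupType) (n : nat) (x : 'I_n -> F) : Prop :=
  forall (H : groupType) (y : 'I_n -> H),
    exists2 f : {multiplicative F -> H}, (forall i, f (x i) = y i) &
      forall g : {multiplicative F -> H}, (forall i, g (x i) = y i) -> g =1 f.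

Definition free_of_rank (F : groupType) (n : nat) : Prop :=
  exists x : 'I_n -> F, free_basis x.

Definition is_subgroup (G : groupType) (A : set G) : Prop :=
  group_closed (fun x => x \in A).

Record subgroup (G : groupType) := Subgroup {
  subgroup_set :> set G;
  subgroupP : is_subgroup subgroup_set }.

HB.instance Definition _ (G : groupType) := gen_eqMixin (subgroup G).
HB.instance Definition _ (G : groupType) := gen_choiceMixin (subgroup G).

Lemma is_subgroupP (G : groupType) (A : set G) :
  is_subgroup A <-> A 1 /\ forall x y, A x -> A y -> A (x * y^-1).
Proof.
split=> -[A1 AF]; split; first exact: set_mem.
- by move=> x y /mem_set Ax /mem_set Ay; apply/set_mem/AF.
- exact: mem_set.
- by move=> x y /set_mem Ax /set_mem Ay; apply/mem_set/AF.
Qed.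

Lemma subgroup_inj (G : groupType) : injective (@subgroup_set G).
Proof.
by move=> [A pA] [B pB] /= eAB; case: B / eAB pB => pB; congr Subgroup.
Qed.

Section SubgroupTheory.
Variables (G : groupType) (A : subgroup G).
Implicit Types x y : G.

Lemma sub1 : subgroup_set A 1.
Proof. by have /is_subgroupP[] := subgroupP A. Qed.

Lemma subF x y : subgroup_set A x -> subgroup_set A y -> subgroup_set A (x * y^-1).
Proof. by have /is_subgroupP[_] := subgroupP A; apply. Qed.

Lemma subV x : subgroup_set A x -> subgroup_set A x^-1.
Proof. by move=> Ax; rewrite -[x^-1]mul1g; apply: subF => //; apply: sub1. Qed.

Lemma subM x y : subgroup_set A x -> subgroup_set A y -> subgroup_set A (x * y).
Proof. by move=> Ax Ay; rewrite -[y]invgK; apply/subF/subV. Qed.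

End SubgroupTheory.

Lemma setT_subgroup (G : groupType) : is_subgroup [set: G].
Proof. exact/is_subgroupP. Qed.

Lemma setI_subgroup (G : groupType) (A B : subgroup G) : is_subgroup (A `&` B).
Proof.
apply/is_subgroupP; split; first by split; apply: sub1.
by move=> x y [? ?] [? ?]; split; apply: subF.
Qed.

Definition full_subgroup (G : groupType) := Subgroup (setT_subgroup G).
Definition subgroupI (G : groupType) (A B : subgroup G) :=
  Subgroup (setI_subgroup A B).

Definition subgroup_type (G : groupType) (A : subgroup G) : Type :=
  {x : G | x \in subgroup_set A}.

HB.instance Definition _ (G : groupType) (A : subgroup G) :=
  SubChoice.on (subgroup_type A).
HB.instance Definition _ (G : groupType) (A : subgroup G) :=
  SubChoice_isSubGroup.Build G (fun x => x \in subgroup_set A) (subgroup_type A)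
    (subgroupP A).

Definition left_coset (G : groupType) (A : set G) (x : G) : set G :=
  [set x * a | a in A].

Definition finite_index (G : groupType) (A : set G) : Prop :=
  finite_set [set left_coset A x | x in [set: G]].

Definition normal_in (G : groupType) (N A : set G) : Prop :=
  N `<=` A /\ forall x y, A x -> N y -> N (y ^ x).

Section Quotient.
Variables (G : groupType) (A N : subgroup G).

Definition coset_rel : rel (subgroup_type A) :=
  fun x y => (val x)^-1 * val y \in subgroup_set N.

Lemma coset_rel_equiv : equiv_class_of coset_rel.
Proof.
split=> [x|x y|y x z]; rewrite /coset_rel.
- by apply/mem_set; rewrite mulVg; apply: sub1.
- by apply/idP/idP => /set_mem/subV; rewrite invgM invgK => /mem_set.
- move=> /set_mem xy /set_mem yz; apply/mem_set.
  by rewrite -[(val z)](mulKVg (val y)) mulgA; apply: subM.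
Qed.

Canonical coset_rel_canonical := EquivRelPack coset_rel_equiv.

(* The proof of normality does not occur in the carrier; it is a parameter
   because the group law below depends on it. *)
Definition quotient_group of normal_in N A : Type := {eq_quot coset_rel}.

Variable nNA : normal_in N A.

HB.instance Definition _ := Choice.on (quotient_group nNA).
HB.instance Definition _ := Quotient.on (quotient_group nNA).
HB.instance Definition _ :
  EqQuotient (subgroup_type A) coset_rel (quotient_group nNA) :=
  EqQuotient.on (quotient_group nNA).

Let Q := quotient_group nNA.

Definition quot_mul (a b : Q) : Q := \pi_Q (repr a * repr b).
Definition quot_inv (a : Q) : Q := \pi_Q (repr a)^-1.
Definition quot_one : Q := \pi_Q 1.

Lemma pi_quotP (x y : subgroup_type A) :
  \pi_Q x = \pi_Q y :> Q <-> subgroup_set N ((val x)^-1 * val y).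
Proof.
split=> [/eqmodP/set_mem //|Nxy].
by apply/eqmodP/mem_set.
Qed.

Lemma repr_quotP (x : subgroup_type A) :
  subgroup_set N ((val (repr (\pi_Q x : Q)))^-1 * val x).
Proof. by apply/pi_quotP; rewrite reprK. Qed.

Lemma quot_mulE x y : quot_mul (\pi_Q x) (\pi_Q y) = \pi_Q (x * y).
Proof.
apply/pi_quotP; have := repr_quotP x; have := repr_quotP y.
move: (repr _) (repr _) => y' x' Ny Nx; rewrite !valM.
have /nNA.2 : subgroup_set A (val y) by apply/set_mem/(valP y).
move/(_ _ Nx); rewrite conjgE => NJ.
have := subM Ny NJ; congr (subgroup_set N _).
by rewrite invgM !mulgA mulgK.
Qed.

Lemma quot_invE x : quot_inv (\pi_Q x) = \pi_Q x^-1.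
Proof.
apply/pi_quotP; have := repr_quotP x; move: (repr _) => x' Nx.
have /nNA.2 /(_ (subV Nx)) : subgroup_set A (val x)^-1.
  by apply/subV/set_mem/(valP x).
by rewrite conjgE !invgM !invgK !mulgA mulgV mul1g.
Qed.

Lemma pi_ex (a : Q) : exists x : subgroup_type A, a = \pi_Q x.
Proof. by exists (repr a); rewrite reprK. Qed.

Fact quot_mulA : associative quot_mul.
Proof.
move=> a b c; case: (pi_ex a) (pi_ex b) (pi_ex c) => [x ->] [y ->] [z ->].
by rewrite !quot_mulE mulgA.
Qed.

Fact quot_mul1g : left_id quot_one quot_mul.
Proof. by move=> a; case: (pi_ex a) => x ->; rewrite quot_mulE mul1g. Qed.

Fact quot_mulg1 : right_id quot_one quot_mul.
Proof. by move=> a; case: (pi_ex a) => x ->; rewrite quot_mulE mulg1. Qed.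

Fact quot_mulVg : left_inverse quot_one quot_inv quot_mul.
Proof. by move=> a; case: (pi_ex a) => x ->; rewrite quot_invE quot_mulE mulVg. Qed.

Fact quot_mulgV : right_inverse quot_one quot_inv quot_mul.
Proof. by move=> a; case: (pi_ex a) => x ->; rewrite quot_invE quot_mulE mulgV. Qed.

HB.instance Definition _ := isGroup.Build (quotient_group nNA)
  quot_mulA quot_mul1g quot_mulg1 quot_mulVg quot_mulgV.

End Quotient.

Definition finite_simple (G : groupType) : Prop :=
  exists S : finGroupType, simple [set: S]%SET /\ group_iso G S.

Definition factor_iso (G : groupType) (A N : subgroup G) (S : finGroupType) : Prop :=
  exists nNA : normal_in N A, group_iso (quotient_group nNA) S.

Definition subnormal (G : groupType) (A : subgroup G) : Prop :=
  exists (l : nat) (C : nat -> subgroup G),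
    [/\ C 0%N = full_subgroup G, C l = A &
        forall i, (i < l)%N -> normal_in (C i.+1) (C i)].

(* Only the terms C 0, ..., C l of the sequence C matter. *)
Definition composition_series (G : groupType) (A : subgroup G)
    (l : nat) (C : nat -> subgroup G) : Prop :=
  [/\ C 0%N = full_subgroup G, C l = A &
      forall i, (i < l)%N ->
        exists nC : normal_in (C i.+1) (C i), finite_simple (quotient_group nC)].

(* The finite simple groups form a large type, so the classes are taken over the
   simple subgroups of the symmetric groups 'S_n; by [FS_cover] below, this
   represents every finite simple group. *)
Record simple_perm_group := SimplePermGroup {
  spg_degree : nat;
  spg_group :> {group 'S_spg_degree};
  spg_simple : simple spg_group }.

HB.instance Definition _ := gen_eqMixin simple_perm_group.
HB.instance Definition _ := gen_choiceMixin simple_perm_group.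

Definition spg_iso : rel simple_perm_group := fun S T => S \isog T.

Lemma spg_iso_equiv : equiv_class_of spg_iso.
Proof.
split=> [S|S T|T S U]; rewrite /spg_iso.
- exact: isog_refl.
- exact: isog_sym.
- exact: isog_trans.
Qed.

Canonical spg_iso_canonical := EquivRelPack spg_iso_equiv.

Definition FS : Type := {eq_quot spg_iso}.

HB.instance Definition _ := Choice.on FS.
HB.instance Definition _ := Quotient.on FS.
HB.instance Definition _ : EqQuotient simple_perm_group spg_iso FS :=
  EqQuotient.on FS.

Definition FS_repr (S : FS) : finGroupType := subg_of (repr S : simple_perm_group).

Lemma group_isoE (gT rT : finGroupType) :
  group_iso gT rT <-> ([set: gT] \isog [set: rT])%SET.
Proof.
split=> [[f bij_f]|/isogP[f inj_f im_f]].
  have fM : {in [set: gT]%SET &, {morph f : x y / x * y}}.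
    by move=> x y _ _; apply: gmulfM.
  apply/isogP; exists (Morphism fM).
    by apply/injmP => x y _ _; apply: bij_inj.
  apply/setP => y; rewrite inE; apply/morphimP.
  by case: bij_f => g _ gK; exists (g y) => //=; rewrite gK.
have fM : {morph f : x y / x * y} by move=> x y; apply: morphM; apply: finset.in_setT.
have fI : injective f.
  by move=> x y; move/injmP: inj_f; apply; apply: finset.in_setT.
pose f' := isMultiplicative.Build gT rT f fM.
pose F : {multiplicative gT -> rT} := HB.pack (f : gT -> rT) f'.
exists F; apply: inj_card_bij => //.
by rewrite -!cardsT -im_f card_injm.
Qed.

Lemma simple_perm_groupP (gT : finGroupType) : simple [set: gT]%SET ->
  exists S : simple_perm_group, ([set: gT] \isog S)%SET.
Proof.
move=> simG.
pose t (g : gT) (i : 'I_#|gT|) := enum_rank (enum_val i * g).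
have t_inj g : injective (t g).
  by move=> i j /enum_rank_inj/mulIg/enum_val_inj.
pose f g := perm (t_inj g).
have fM : {in [set: gT]%SET &, {morph f : x y / x * y}}.
  move=> x y _ _; apply/permP => i.
  by rewrite permM !permE /t enum_rankK mulgA.
have iso : ([set: gT] \isog Morphism fM @* [set: gT])%SET.
  apply: sub_isog => //; apply/injmP => x y _ _ /= /permP/(_ (enum_rank 1)).
  by rewrite !permE /t => /enum_rank_inj/mulgI.
have simI : simple (Morphism fM @* [set: gT])%SET by rewrite -(isog_simple iso).
by exists (@SimplePermGroup #|gT| [group of Morphism fM @* [set: gT]%SET] simI).
Qed.

Lemma FS_cover (gT : finGroupType) : simple [set: gT]%SET ->
  exists! S : FS, group_iso gT (FS_repr S).
Proof.
move=> /simple_perm_groupP[S isoS]; exists (\pi_FS S); split.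
  apply/group_isoE; apply: (isog_trans isoS).
  apply: isog_trans (isog_subg _).
  change (spg_iso S (repr (\pi_FS S))).
  have: \pi_FS S = \pi_FS (repr (\pi_FS S)) by rewrite reprK.
  by move/eqmodP.
move=> T /group_isoE isoT; rewrite -[T]reprK; apply/eqmodP.
have isoST : (S \isog [set: FS_repr T])%SET.
  by apply: isog_trans isoT; rewrite isog_sym.
by apply: isog_trans isoST _; rewrite isog_sym; apply: isog_subg.
Qed.

Record viso (G : groupType) := Viso {
  vdom : subgroup G;
  vcod : subgroup G;
  (* only the values on [vdom] matter *)
  vfun :> G -> G;
  vdom_index : finite_index vdom;
  vcod_index : finite_index vcod;
  vfun_bij : set_bij vdom vcod vfun;
  vfun_morph : {in subgroup_set vdom &, {morph vfun : x y / x * y}} }.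

HB.instance Definition _ (G : groupType) := gen_eqMixin (viso G).
HB.instance Definition _ (G : groupType) := gen_choiceMixin (viso G).

Section FiniteIndex.
Variable G : groupType.

Lemma left_cosetP (A : subgroup G) x y :
  left_coset A x = left_coset A y <-> subgroup_set A (x^-1 * y).
Proof.
split=> [xy|Axy].
  have : left_coset A y y by exists 1; rewrite ?mulg1//; apply: sub1.
  by rewrite -xy => -[a Aa <-]; rewrite mulKg.
apply/seteqP; split=> _ [a Aa <-].
  exists (y^-1 * x * a); last by rewrite -!mulgA mulKVg.
  by apply: subM Aa; rewrite -[x]invgK -invgM; apply: subV.
by exists (x^-1 * y * a); [apply: subM | rewrite -!mulgA mulKVg].
Qed.

Lemma finite_index_color (A K : subgroup G) T (c : G -> T) :
  finite_index A -> finite_set (c @` A) ->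
  (forall x y, subgroup_set A x -> subgroup_set A y -> c x = c y ->
     subgroup_set K (x^-1 * y)) ->
  finite_index K.
Proof.
move=> fA fc cK.
pose r (X : set G) := xget 1 X.
pose D := [set left_coset A x | x in [set: G]] `*` (c @` A).
pose P (t : set G * T) (x : G) :=
  t.1 = left_coset A x /\ subgroup_set A ((r t.1)^-1 * x) /\
  t.2 = c ((r t.1)^-1 * x).
pose h (t : set G * T) := left_coset K (xget 1 (P t)).
apply: (@sub_finite_set _ _ (h @` D)); last first.
  by apply: finite_image; apply: finite_setX.
move=> _ [x _ <-].
have rx : subgroup_set A ((r (left_coset A x))^-1 * x).
  apply/left_cosetP; rewrite /r; case: xgetP => [y _ [a Aa <-]|/(_ x)[]].
    by apply/left_cosetP; rewrite invgM -mulgA mulVg mulg1; apply: subV.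
  by exists 1; rewrite ?mulg1//; apply: sub1.
set t := (left_coset A x, c ((r (left_coset A x))^-1 * x)).
have Pt : P t x by split.
exists t; first by split=> //=; [exists x | exists ((r (left_coset A x))^-1 * x)].
rewrite /h; have /= [_ [Az cz]] := xgetPex 1 (ex_intro _ x Pt).
move: (xget _ _) Az cz => z Az cz; apply/left_cosetP.
have := cK _ _ Az rx (esym cz).
by rewrite invgM invgK -mulgA mulKVg.
Qed.

Lemma finite_indexT : finite_index [set: G].
Proof.
apply: (@sub_finite_set _ _ [set [set: G]]); last exact: finite_set1.
move=> _ [x _ <-]; apply/seteqP; split=> // y _.
by exists (x^-1 * y); rewrite ?mulKVg.
Qed.

Lemma finite_indexI (A B : subgroup G) :
  finite_index A -> finite_index B -> finite_index (A `&` B).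
Proof.
move=> fA fB; apply: (@finite_index_color A (subgroupI A B) _ (left_coset B)) => //.
  by apply: sub_finite_set fB => _ [x _ <-]; exists x.
move=> x y Ax Ay /left_cosetP Bxy; split=> //.
by apply: subM => //; apply: subV.
Qed.

End FiniteIndex.

Section Viso.
Variable G : groupType.
Implicit Types (phi psi : viso G) (C : subgroup G).

Lemma vfun_cod phi x : subgroup_set (vdom phi) x -> subgroup_set (vcod phi) (phi x).
Proof. by have [f _ _] := vfun_bij phi; apply: f. Qed.

Lemma vfun_inj phi x y : subgroup_set (vdom phi) x -> subgroup_set (vdom phi) y ->
  phi x = phi y -> x = y.
Proof. by have [_ i _] := vfun_bij phi => ? ?; apply: i; apply: mem_set. Qed.

Lemma vfun_surj phi y : subgroup_set (vcod phi) y ->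
  exists2 x, subgroup_set (vdom phi) x & phi x = y.
Proof. by have [_ _ s] := vfun_bij phi; apply: s. Qed.

Lemma vfunM phi x y : subgroup_set (vdom phi) x -> subgroup_set (vdom phi) y ->
  phi (x * y) = phi x * phi y.
Proof. by move=> ? ?; apply: vfun_morph; apply: mem_set. Qed.

Lemma vfun1 phi : phi 1 = 1.
Proof.
apply: (mulgI (phi 1)); rewrite -vfunM ?mulg1//; exact: sub1.
Qed.

Lemma vfunV phi x : subgroup_set (vdom phi) x -> phi x^-1 = (phi x)^-1.
Proof.
move=> Ax; apply: (mulgI (phi x)).
by rewrite -vfunM ?mulgV ?vfun1//; apply: subV.
Qed.

Lemma preim_subgroup phi C : is_subgroup (vdom phi `&` phi @^-1` C).
Proof.
apply/is_subgroupP; split; first by split=> /=; rewrite ?vfun1; apply: sub1.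
move=> x y [Ax Cx] [Ay Cy]; split=> /=; first exact: subF.
by rewrite vfunM ?vfunV//; [apply: subF | apply: subV].
Qed.

Lemma preim_index phi C :
  finite_index C -> finite_index (vdom phi `&` phi @^-1` C).
Proof.
move=> fC.
apply: (@finite_index_color _ (vdom phi) (Subgroup (preim_subgroup phi C)) _
  (left_coset C \o phi)); first exact: vdom_index.
  by apply: sub_finite_set fC => _ [x _ <-]; exists (phi x).
move=> x y Ax Ay /left_cosetP; rewrite -vfunV// -vfunM//; last exact: subV.
by move=> Cxy; split=> //; apply: subM => //; apply: subV.
Qed.

Definition vinv_fun phi (y : G) : G :=
  xget 1 [set x | subgroup_set (vdom phi) x /\ phi x = y].

Lemma vinv_funP phi y : subgroup_set (vcod phi) y ->
  subgroup_set (vdom phi) (vinv_fun phi y) /\ phi (vinv_fun phi y) = y.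
Proof.
move=> /vfun_surj[x Ax xy].
exact: (xgetPex 1 (ex_intro [set x | _ /\ _] x (conj Ax xy))).
Qed.

Lemma vfunK phi x : subgroup_set (vdom phi) x -> vinv_fun phi (phi x) = x.
Proof.
move=> Ax; have [Ay e] := vinv_funP (vfun_cod Ax); exact: vfun_inj e.
Qed.

Lemma vinv_bij phi : set_bij (vcod phi) (vdom phi) (vinv_fun phi).
Proof.
split.
- by move=> y /vinv_funP[].
- move=> y z /set_mem By /set_mem Bz e.
  by rewrite -(vinv_funP By).2 e (vinv_funP Bz).2.
- by move=> x Ax; exists (phi x); [apply: vfun_cod | apply: vfunK].
Qed.

Lemma vinv_morph phi :
  {in subgroup_set (vcod phi) &, {morph vinv_fun phi : x y / x * y}}.
Proof.
move=> y z /set_mem By /set_mem Bz.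
have [Ay ey] := vinv_funP By; have [Az ez] := vinv_funP Bz.
by rewrite -{1}ey -{1}ez -vfunM// vfunK//; apply: subM.
Qed.

Definition vinv phi : viso G :=
  Viso (vcod_index phi) (vdom_index phi) (vinv_bij phi) (vinv_morph (phi := phi)).

Lemma vid_bij : set_bij (full_subgroup G) (full_subgroup G) (@idfun G).
Proof. by split=> //= y _; exists y. Qed.

Definition vid : viso G :=
  @Viso G (full_subgroup G) (full_subgroup G) idfun
    (finite_indexT G) (finite_indexT G) vid_bij (fun x y _ _ => erefl).

Section Composition.
Variables phi psi : viso G.
Let I := subgroupI (vcod phi) (vdom psi).

Lemma vcomp_dom_subgroup : is_subgroup (vdom phi `&` phi @^-1` I).
Proof. exact: preim_subgroup. Qed.

Lemma vcomp_codE : psi @` I = vdom (vinv psi) `&` vinv psi @^-1` I.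
Proof.
apply/seteqP; split=> [_ [x [Bx Cx] <-]|y [Dy /= Iy]].
  by split=> /=; [apply: vfun_cod | rewrite vfunK].
by exists (vinv_fun psi y) => //; have [] := vinv_funP Dy.
Qed.

Lemma vcomp_cod_subgroup : is_subgroup (psi @` I).
Proof. by rewrite vcomp_codE; apply: preim_subgroup. Qed.

Lemma vcomp_dom_index : finite_index (vdom phi `&` phi @^-1` I).
Proof.
apply/preim_index/finite_indexI; [exact: vcod_index | exact: vdom_index].
Qed.

Lemma vcomp_cod_index : finite_index (psi @` I).
Proof.
rewrite vcomp_codE.
apply/preim_index/finite_indexI; [exact: vcod_index | exact: vdom_index].
Qed.

Lemma vcomp_bij : set_bij (vdom phi `&` phi @^-1` I) (psi @` I) (psi \o phi).
Proof.
split.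
- by move=> x [Ax Ix]; exists (phi x).
- move=> x y /set_mem[Ax [_ Cx]] /set_mem[Ay [_ Cy]] /(vfun_inj Cx Cy).
  exact: vfun_inj.
- move=> _ [y [By Cy] <-]; have [x Ax xy] := vfun_surj By.
  by exists x; rewrite /= ?xy//; split=> //=; rewrite xy.
Qed.

Lemma vcomp_morph :
  {in vdom phi `&` phi @^-1` I &, {morph psi \o phi : x y / x * y}}.
Proof.
by move=> x y /set_mem[Ax [_ Cx]] /set_mem[Ay [_ Cy]]; rewrite /= !vfunM.
Qed.

(* phi followed by psi *)
Definition vcomp : viso G :=
  @Viso G (Subgroup vcomp_dom_subgroup) (Subgroup vcomp_cod_subgroup)
    (psi \o phi) vcomp_dom_index vcomp_cod_index vcomp_bij vcomp_morph.

End Composition.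

Definition viso_agree phi psi : Prop :=
  exists C, [/\ finite_index C, C `<=` vdom phi, C `<=` vdom psi &
               forall x, subgroup_set C x -> phi x = psi x].

Definition viso_equiv : rel (viso G) := fun phi psi => `[< viso_agree phi psi >].

Lemma viso_agreeI phi psi :
  (forall x, subgroup_set (vdom phi) x -> subgroup_set (vdom psi) x ->
     phi x = psi x) ->
  viso_agree phi psi.
Proof.
move=> e; exists (subgroupI (vdom phi) (vdom psi)); split.
- by apply: finite_indexI; apply: vdom_index.
- by move=> x [].
- by move=> x [].
- by move=> x []; apply: e.
Qed.

Lemma viso_equiv_class : equiv_class_of viso_equiv.
Proof.
have sym phi psi : viso_equiv phi psi -> viso_equiv psi phi.
  move=> /asboolP[C [fC C1 C2 e]]; apply/asboolP; exists C.
  by split=> // x /e.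
split=> [phi|phi psi|psi phi xi].
- by apply/asboolP/viso_agreeI.
- by apply/idP/idP; apply: sym.
- move=> /asboolP[C [fC C1 C2 eC]] /asboolP[D [fD D1 D2 eD]].
  apply/asboolP; exists (subgroupI C D); split.
  + exact: finite_indexI.
  + by move=> x [/C1].
  + by move=> x [_ /D2].
  + by move=> x [/eC -> /eD].
Qed.

Canonical viso_equiv_canonical := EquivRelPack viso_equiv_class.

Lemma vcomp_agree phi phi' psi psi' : viso_agree phi phi' -> viso_agree psi psi' ->
  viso_agree (vcomp phi psi) (vcomp phi' psi').
Proof.
move=> [C [fC C1 C2 eC]] [D [fD D1 D2 eD]].
exists (subgroupI C (Subgroup (preim_subgroup phi D))); split.
- by apply: finite_indexI => //; apply: preim_index.
- move=> x [Cx [Ax Dx]]; split=> //; split; first exact: vfun_cod.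
  exact: D1.
- move=> x [Cx [Ax Dx]]; split; first exact: C2.
  rewrite /preimage/= -eC//; split; last exact: D2.
  by rewrite eC//; apply/vfun_cod/C2.
- by move=> x [Cx [Ax Dx]] /=; rewrite eD// eC.
Qed.

Lemma vinv_agree phi psi : viso_agree phi psi -> viso_agree (vinv phi) (vinv psi).
Proof.
move=> [C [fC C1 C2 eC]].
exists (Subgroup (preim_subgroup (vinv phi) C)); split.
- exact: preim_index.
- by move=> y [].
- move=> y [/= By Cy]; have [Ax xy] := vinv_funP By.
  by rewrite -xy eC//; apply/vfun_cod/C2.
- move=> y [/= By Cy]; have [Ax xy] := vinv_funP By.
  by rewrite -[in RHS]xy eC// vfunK//; apply: C2.
Qed.

End Viso.

Definition Comm (G : groupType) : Type := {eq_quot @viso_equiv G}.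

HB.instance Definition _ (G : groupType) := Choice.on (Comm G).
HB.instance Definition _ (G : groupType) := Quotient.on (Comm G).
HB.instance Definition _ (G : groupType) :
  EqQuotient (viso G) (@viso_equiv G) (Comm G) := EqQuotient.on (Comm G).

Section CommGroup.
Variable G : groupType.

Definition comm_class (phi : viso G) : Comm G := \pi_(Comm G) phi.

(* As for maps, the product c * d stands for d followed by c. *)
Definition comm_mul (c d : Comm G) : Comm G := comm_class (vcomp (repr d) (repr c)).
Definition comm_inv (c : Comm G) : Comm G := comm_class (vinv (repr c)).
Definition comm_one : Comm G := comm_class (vid G).

Lemma comm_classP (phi psi : viso G) :
  comm_class phi = comm_class psi <-> viso_agree phi psi.
Proof.
by split=> [/eqmodP/asboolP //|?]; apply/eqmodP/asboolP.
Qed.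

Lemma comm_class_ex (c : Comm G) : exists phi, c = comm_class phi.
Proof. by exists (repr c); rewrite /comm_class reprK. Qed.

Lemma comm_repr (phi : viso G) : viso_agree (repr (comm_class phi)) phi.
Proof. by apply/comm_classP; rewrite /comm_class reprK. Qed.

Lemma comm_mulE phi psi :
  comm_mul (comm_class psi) (comm_class phi) = comm_class (vcomp phi psi).
Proof. by apply/comm_classP/vcomp_agree; apply: comm_repr. Qed.

Lemma comm_invE phi : comm_inv (comm_class phi) = comm_class (vinv phi).
Proof. by apply/comm_classP/vinv_agree/comm_repr. Qed.

Fact comm_mulA : associative comm_mul.
Proof.
move=> a b c.
case: (comm_class_ex a) (comm_class_ex b) (comm_class_ex c) => f -> [g ->] [h ->].
by rewrite !comm_mulE; apply/comm_classP/viso_agreeI.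
Qed.

Fact comm_mul1g : left_id comm_one comm_mul.
Proof.
move=> a; case: (comm_class_ex a) => f ->.
by rewrite comm_mulE; apply/comm_classP/viso_agreeI.
Qed.

Fact comm_mulg1 : right_id comm_one comm_mul.
Proof.
move=> a; case: (comm_class_ex a) => f ->.
by rewrite comm_mulE; apply/comm_classP/viso_agreeI.
Qed.

Fact comm_mulVg : left_inverse comm_one comm_inv comm_mul.
Proof.
move=> a; case: (comm_class_ex a) => f ->; rewrite comm_invE comm_mulE.
by apply/comm_classP/viso_agreeI => x [Ax _] _; apply: vfunK.
Qed.

Fact comm_mulgV : right_inverse comm_one comm_inv comm_mul.
Proof.
move=> a; case: (comm_class_ex a) => f ->; rewrite comm_invE comm_mulE.
by apply/comm_classP/viso_agreeI => x [/vinv_funP[_ e] _] _.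
Qed.

HB.instance Definition _ := isGroup.Build (Comm G)
  comm_mulA comm_mul1g comm_mulg1 comm_mulVg comm_mulgV.

End CommGroup.

(* The image of a_A : Aut(A) -> Comm(G); an automorphism of A is a virtual
   isomorphism of G whose domain and codomain are A. *)
Definition aut_image (G : groupType) (A : subgroup G) : set (Comm G) :=
  [set comm_class phi | phi in [set phi : viso G | vdom phi = A /\ vcod phi = A]].

Definition AComm (G : groupType) : set (Comm G) :=
  smallest (@is_subgroup (Comm G))
    (\bigcup_(A in [set A : subgroup G | finite_index A]) aut_image A).
Arguments AComm G : clear implicits.

Section Multiplicity.
Variable G : groupType.

(* A composition series going from A to G, whenever there is one; by Jordan-Hoelder
   the multiplicities below do not depend on the choice. *)
Definition some_series (A : subgroup G) : nat * (nat -> subgroup G) :=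
  xget (0%N, fun=> A) [set s | composition_series A s.1 s.2].

Definition factor_count (A : subgroup G) (S : FS) : nat :=
  let s := some_series A in
  #|[set i : 'I_s.1 | `[< factor_iso (s.2 i) (s.2 i.+1) (FS_repr S) >] ]%SET|.

Definition subnormal_viso (phi : viso G) : Prop :=
  subnormal (vdom phi) /\ subnormal (vcod phi).

Definition subnormal_repr (c : Comm G) : viso G :=
  xget (vid G) [set phi | subnormal_viso phi /\ comm_class phi = c].

Definition dmap (c : Comm G) : {freeg FS} :=
  let phi := subnormal_repr c in
  (\sum_(S \in [set: FS])
     << (factor_count (vcod phi) S)%:Z - (factor_count (vdom phi) S)%:Z *g S >>)%R.

End Multiplicity.

(* Main.v *)
Require Import Defs.
From HB Require Import structures.
From mathcomp Require Import all_boot all_order all_algebra.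
From mathcomp Require Import all_fingroup gseries.
From mathcomp Require Import generic_quotient freeg boolp classical_sets.
From mathcomp Require Import functions cardinality fsbigop.
From mathcomp Require Import zify.

(** That [AComm F] lies in the kernel is a matter of counting composition factors.
    By Jordan-Hoelder the factors between two nested subnormal subgroups of finite
    index form a well-defined multiset, which adds up along chains and is preserved
    by isomorphisms. Given an automorphism [phi] of a finite index subgroup [A],
    let [N] be the normal core of [A]. The subgroups [K = phi N :&: N] and
    [L = phi^-1 K] have the same factors in [A], because [phi] maps [L] to [K] and
    [A] to itself; as both lie in [N], they have the same factors in [N], hence in
    [F] ([aut_balanced]).

    For the other inclusion let [phi : A -> B] be such that [A] and [B] have the
    same factors in [F]. Three facts about free groups enter.

    - Automorphisms of a free group of rank [m] act transitively on epimorphisms to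
      a finite group [S], when [m >= 2 #|S|] or when [#|S|] is prime and [m >= 2]
      ([aut_transitive]): superfluous basis elements can be sent to a fixed
      generating family of [S], which makes all the other ones superfluous.
    - By Nielsen-Schreier ([schreier]) the kernel of a map onto a finite group [Q]
      has rank [#|Q| (m - 1) + 1]; so ranks do not decrease along a composition
      series, and they become large with [#|Q|].
    - Consequently two subgroups [X] and [Y] of a free group [D] of large rank that
      have the same composition factors in [D] are exchanged by an element of
      [AComm F] ([same_factors_AComm]). If the top factors of the two series are
      equal, move one top term to the other by an automorphism of [D] and go on
      inside it. If they are [S] and [T], compare [X] and [Y] with a subgroup [Z]
      of the kernel of a map of [D] onto [S * T], which has series of both kinds.

    The rank of [F] itself may be too small for this. It is enlarged by passing to
    the kernel [D] of a map of [F] onto a cyclic group of large prime order [q],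
    which is coprime to the indices of [A] and [B]: the factors of [A :&: D] and
    [B :&: D] in [D] are those of [A] and [B] in [F]. So some [psi] in [AComm F]
    maps [A :&: D] to [B :&: D]. Now [A :&: D] and [phi^-1 (B :&: D)] are normal of
    prime index [q] in [A], so an automorphism [h] of [A] maps the one to the other,
    and [psi^-1 \o phi \o h] is an automorphism of [A :&: D]
    ([same_multiplicity_AComm]). *)

Set Implicit Arguments.
Unset Strict Implicit.
Unset Printing Implicit Defensive.

Local Open Scope classical_set_scope.

(* A subgroup coerces to a set, but not to a predicate that could be applied. *)
Local Notation "x \isin A" := (subgroup_set A x) (at level 70).

(** * Homomorphisms defined on a subgroup *)

Section PartialHom.
Local Open Scope group_scope.
Variable F : groupType.
Implicit Types (A B N X Y : subgroup F) (K : groupType).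

(** Everything takes place inside one group [F]: a map defined on a subgroup is a
    total function of which only the values on the subgroup matter. *)
Definition hom_on (A : set F) K (f : F -> K) : Prop :=
  forall x y, A x -> A y -> f (x * y) = f x * f y.

Definition epi_on (A : set F) K (f : F -> K) : Prop :=
  hom_on A f /\ forall k, exists2 a, A a & f a = k.

Definition is_kernel (A : set F) K (f : F -> K) (N : set F) : Prop :=
  forall x, N x <-> A x /\ f x = 1.

Lemma subgroup_ext A B : (forall x, x \isin A <-> x \isin B) -> A = B.
Proof. by move=> e; apply/subgroup_inj/seteqP; split=> x /e. Qed.

Lemma hom1 A K (f : F -> K) : hom_on A f -> f 1 = 1.
Proof.
by move=> h; apply: (mulgI (f 1)); rewrite -h ?mulg1//; apply: sub1.
Qed.

Lemma homV A K (f : F -> K) x : hom_on A f -> x \isin A -> f x^-1 = (f x)^-1.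
Proof.
move=> h Ax; apply: (mulgI (f x)).
by rewrite -h ?mulgV ?(hom1 h)//; apply: subV.
Qed.

Lemma homVM A K (f : F -> K) x y : hom_on A f -> x \isin A -> y \isin A ->
  f (x^-1 * y) = (f x)^-1 * f y.
Proof. by move=> h Ax Ay; rewrite h ?(homV h)//; apply: subV. Qed.

Lemma homJ A K (f : F -> K) x y : hom_on A f -> x \isin A -> y \isin A ->
  f (y ^ x) = f y ^ f x.
Proof.
move=> h Ax Ay; rewrite /conjg (homVM h)// ?h//.
by apply: subM.
Qed.

Lemma sub_hom (A B : set F) K (f : F -> K) : A `<=` B -> hom_on B f -> hom_on A f.
Proof. by move=> sAB h x y /sAB ? /sAB; apply: h. Qed.

Lemma subJ A x y : x \isin A -> y \isin A -> (y ^ x) \isin A.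
Proof.
by move=> Ax Ay; rewrite /conjg; apply: subM; [apply: subV|apply: subM].
Qed.

Lemma equalizer_subgroup A K (f g : F -> K) : hom_on A f -> hom_on A g ->
  is_subgroup (A `&` [set x | f x = g x]).
Proof.
move=> hf hg; apply/is_subgroupP; split.
  by split; [apply: sub1 | rewrite /= (hom1 hf) (hom1 hg)].
move=> x y [Ax /= ex] [Ay /= ey]; split; first exact: subF.
by rewrite /= hf ?hg ?(homV hf) ?(homV hg) ?ex ?ey//; apply: subV.
Qed.

Lemma preim_is_subgroup A K (f : F -> K) (P : K -> Prop) : hom_on A f -> P 1 ->
  (forall a b, P a -> P b -> P (a * b^-1)) -> is_subgroup (A `&` [set x | P (f x)]).
Proof.
move=> hf P1 PF; apply/is_subgroupP; split.
  by split; [apply: sub1 | rewrite /= (hom1 hf)].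
move=> x y [Ax /= ex] [Ay /= ey]; split; first exact: subF.
by rewrite /= hf ?(homV hf)//; [apply: PF | apply: subV].
Qed.

Lemma kernel_ex A K (f : F -> K) : hom_on A f ->
  exists N : subgroup F, is_kernel A f N.
Proof.
move=> hf; have sN : is_subgroup (A `&` [set x | f x = 1]).
  by apply: (@preim_is_subgroup A K f (fun k => k = 1)) => // a b -> ->;
     rewrite mulgV.
by exists (Subgroup sN).
Qed.

Lemma kernel_sub A K (f : F -> K) N : is_kernel A f N -> N `<=` A.
Proof. by move=> kN x /kN[]. Qed.

Lemma kernel_normal A K (f : F -> K) N : hom_on A f -> is_kernel A f N ->
  normal_in N A.
Proof.
move=> hf kN; split; first exact: kernel_sub kN.
move=> x y Ax /kN[Ay fy]; apply/kN; split; first exact: subJ.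
by rewrite (homJ hf) // fy conj1g.
Qed.

Lemma image_group A (gT : finGroupType) (f : F -> gT) : hom_on A f ->
  exists H : {group gT}, forall q,
    q \in H <-> exists2 x, x \isin A & f x = q.
Proof.
move=> hf; pose H := [set q | `[< exists2 x, x \isin A & f x = q >]]%SET.
have HP q : reflect (exists2 x, x \isin A & f x = q) (q \in H).
  by rewrite finset.inE; apply: asboolP.
have gH : group_set H.
  apply/group_setP; split.
    by apply/HP; exists 1; [apply: sub1 | apply: hom1 hf].
  move=> _ _ /HP[x Ax <-] /HP[y Ay <-]; apply/HP; exists (x * y).
    exact: subM.
  exact: hf.
by exists (Group gH) => q; split=> /HP.
Qed.

Lemma finite_index_ker A (Q : finGroupType) (f : F -> Q) N :
  hom_on A f -> is_kernel A f N -> finite_index A -> finite_index N.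
Proof.
move=> hf kN fA; apply: (@finite_index_color F A N Q f) => //.
move=> x y Ax Ay e; apply/kN; split; first by apply: subM => //; apply: subV.
by rewrite (homVM hf)// e mulVg.
Qed.

Definition iso_on A B (f : F -> F) : Prop :=
  hom_on A f /\ set_bij A B f.

Lemma iso_onP A B (f : F -> F) : hom_on A f ->
  (forall x, x \isin A -> f x \isin B) -> (forall x, x \isin A -> f x = 1 -> x = 1) ->
  (forall y, y \isin B -> exists2 x, x \isin A & f x = y) -> iso_on A B f.
Proof.
move=> hf fB fI fS; split=> //; split.
- by move=> x /fB.
- move=> x y /set_mem Ax /set_mem Ay e.
  apply: (@mulgI _ x^-1); rewrite mulVg; apply: esym; apply: fI.
    by apply: subM => //; apply: subV.
  by rewrite (homVM hf)// e mulVg.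
- by move=> y /fS[x Ax <-]; exists x.
Qed.

Lemma iso_on_inj A B (f : F -> F) x y : iso_on A B f ->
  x \isin A -> y \isin A ->
  f x = f y -> x = y.
Proof. by move=> [_ [_ i _]] ? ?; apply: i; apply: mem_set. Qed.

Lemma image_subgroup A B N (f : F -> F) : iso_on A B f -> N `<=` A ->
  is_subgroup (f @` N).
Proof.
move=> [hf _] sN; apply/is_subgroupP; split.
  by exists 1; [apply: sub1 | apply: hom1 hf].
move=> _ _ [x Nx <-] [y Ny <-]; exists (x * y^-1); first exact: subF.
by rewrite hf ?(homV hf)//; [apply: sN|apply: sN|apply/subV/sN].
Qed.

Lemma iso_on_sub A B N (f : F -> F) : iso_on A B f -> N `<=` A ->
  exists2 M : subgroup F, subgroup_set M = f @` N & iso_on N M f.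
Proof.
move=> If sN; exists (Subgroup (image_subgroup If sN)) => //.
have [hf [_ i _]] := If; split; first exact: sub_hom hf.
split.
- by move=> x Nx; exists x.
- by move=> x y /set_mem/sN Ax /set_mem/sN Ay; apply: i; apply: mem_set.
- by move=> y [x Nx <-]; exists x.
Qed.

Lemma iso_on_inv A B (f : F -> F) : iso_on A B f -> exists2 g, iso_on B A g &
  (forall x, x \isin A -> g (f x) = x) /\ (forall y, y \isin B -> f (g y) = y).
Proof.
move=> If; have [hf [fB _ fS]] := If.
pose g y := xget 1 [set x | x \isin A /\ f x = y].
have gP y : y \isin B -> g y \isin A /\ f (g y) = y.
  move=> /fS[x Ax xy].
  exact: (xgetPex 1 (ex_intro [set x | x \isin A /\ f x = y] x (conj Ax xy))).
have gK x : x \isin A -> g (f x) = x.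
  move=> Ax; have [Ag e] := gP _ (fB _ Ax); exact: iso_on_inj If Ag Ax e.
exists g; last by split=> // y /gP[].
apply: iso_onP => //.
- move=> y z /gP[Ay ey] /gP[Az ez]; rewrite -{1}ey -{1}ez -hf// gK//.
  exact: subM.
- by move=> y /gP[].
- by move=> y /gP[_ e] g1; rewrite -e g1 (hom1 hf).
- by move=> x Ax; exists (f x); [apply: fB | apply: gK].
Qed.

Lemma iso_on_comp A B C (f g : F -> F) : iso_on A B f -> iso_on B C g ->
  iso_on A C (g \o f).
Proof.
move=> [hf bf] [hg bg]; split; last exact: set_bij_comp bf bg.
case: bf => fB _ _.
by move=> x y Ax Ay /=; rewrite hf// hg//; apply: fB.
Qed.

End PartialHom.

(** * Jordan-Hoelder for subnormal subgroups of finite index *)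

Section Factors.
Local Open Scope group_scope.
Variable F : groupType.
Implicit Types (A B L N M X Y : subgroup F) (S T : FS).

Lemma factor_hom B (K K' : groupType) (f : F -> K) (g : F -> K') :
    epi_on B f -> hom_on B g ->
    (forall x, x \isin B -> f x = 1 -> g x = 1) ->
  exists h : {multiplicative K -> K'}, forall x, x \isin B -> h (f x) = g x.
Proof.
move=> [hf sf] hg kfg.
pose s k := xget 1 [set x | x \isin B /\ f x = k].
have sP k : s k \isin B /\ f (s k) = k.
  have [x Bx xk] := sf k.
  exact: (xgetPex 1 (ex_intro [set x | x \isin B /\ f x = k] x (conj Bx xk))).
have gE x y : x \isin B -> y \isin B -> f x = f y -> g x = g y.
  move=> Bx By e; apply: (mulgI (g y)^-1); rewrite mulVg -(homVM hg)//.
  apply: kfg; first by apply: subM => //; apply: subV.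
  by rewrite (homVM hf)// e mulVg.
have hM : {morph (g \o s) : x y / x * y}.
  move=> x y /=; have [Bx ex] := sP x; have [By ey] := sP y.
  rewrite -hg//; have [Bxy exy] := sP (x * y).
  by apply: gE => //; rewrite ?hf ?exy ?ex ?ey//; apply: subM.
pose hm := isMultiplicative.Build K K' (g \o s) hM.
pose h : {multiplicative K -> K'} := HB.pack (g \o s) hm.
exists h => x Bx /=; have [By ey] := sP (f x); exact: gE.
Qed.

Lemma epi_group_iso B (K K' : groupType) (f : F -> K) (g : F -> K') :
    epi_on B f -> epi_on B g ->
    (forall x, x \isin B -> f x = 1 <-> g x = 1) ->
  group_iso K K'.
Proof.
move=> ef eg kfg.
have [h hE] := factor_hom ef eg.1 (fun x Bx => (kfg x Bx).1).
have [h' hE'] := factor_hom eg ef.1 (fun x Bx => (kfg x Bx).2).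
exists h; exists h' => [k|k].
  by have [x Bx <-] := ef.2 k; rewrite hE// hE'.
by have [x Bx <-] := eg.2 k; rewrite hE'// hE.
Qed.

Lemma FS_simple S : simple [set: FS_repr S]%SET.
Proof.
by rewrite -(isog_simple (isog_subg (repr S : simple_perm_group))) spg_simple.
Qed.

Lemma FS_iso_eq S T : group_iso (FS_repr S) (FS_repr T) -> S = T.
Proof.
move=> iST; have [U [_ uniqU]] := FS_cover (FS_simple S).
rewrite -(uniqU _ iST); apply/esym/uniqU; apply/group_isoE; exact: isog_refl.
Qed.

Definition step B N S : Prop :=
  exists2 f : F -> FS_repr S, epi_on B f & is_kernel B f N.

Lemma step_uniq B N S T : step B N S -> step B N T -> S = T.
Proof.
move=> [f ef kf] [g eg kg]; apply: FS_iso_eq; apply: (epi_group_iso ef eg).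
move=> x Bx; split=> e.
  by have /kg[] : x \isin N by apply/kf.
by have /kf[] : x \isin N by apply/kg.
Qed.

Lemma step_normal B N S : step B N S -> normal_in N B.
Proof. by move=> [f [hf _] kf]; apply: kernel_normal hf kf. Qed.

Lemma step_sub B N S : step B N S -> N `<=` B.
Proof. by move=> /step_normal[]. Qed.

(** The image of [L] is a normal subgroup of a simple group. *)
Lemma simple_image B L S (f : F -> FS_repr S) : epi_on B f -> normal_in L B ->
  (forall x, x \isin L -> f x = 1) \/ epi_on L f.
Proof.
move=> [hf sf] [sLB nLB].
have [H HP] := image_group (sub_hom sLB hf).
have nH : H <| [set: FS_repr S]%SET.
  apply/normalP; split; first exact: finset.subsetT.
  move=> q _; have [b Bb <-] := sf q.
  apply/eqP; rewrite eqEcard cardJg leqnn andbT; apply/fintype.subsetP => z.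
  move=> /imsetP[_ /HP[x Lx <-] ->]; apply/HP; exists (x ^ b).
    exact: nLB.
  by rewrite (homJ hf)//; apply: sLB.
have /simpleP[_ /(_ _ nH)[H1|HT]] := FS_simple S.
  left=> x Lx; have : f x \in H by apply/HP; exists x.
  by rewrite H1 finset.inE => /eqP.
right; split; first exact: sub_hom hf.
by move=> q; apply/HP; rewrite HT finset.inE.
Qed.

(** The factors [s] are read from the top: its head is the factor next to [B]. *)
Fixpoint series B (s : seq FS) A : Prop :=
  if s is C :: s' then exists2 N, step B N C & series N s' A else B = A.

Lemma series_sub B s A : series B s A -> A `<=` B.
Proof.
elim: s B => [B ->//|S s IH B /= [N /step_sub sNB /IH sAN]].
by move=> x /sAN/sNB.
Qed.

Lemma series_cat B s N t A : series B s N -> series N t A -> series B (s ++ t) A.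
Proof.
elim: s B => [B -> //|S s IH B /= [X sX sXN] tA].
by exists X => //; apply: IH.
Qed.

Lemma series_finite_index B s A : series B s A -> finite_index B -> finite_index A.
Proof.
elim: s B => [B -> //|S s IH B /= [N [f ef kf] /IH sN] fB].
exact/sN/(finite_index_ker ef.1 kf).
Qed.

Lemma step_iso B N S B' N' (f : F -> F) : iso_on B B' f -> iso_on N N' f ->
  step B N S -> step B' N' S.
Proof.
move=> fB fN [g [hg sg] kg]; have [h hB [hK fK]] := iso_on_inv fB.
have sNB : N `<=` B := kernel_sub kg.
have [hhB [hcod _ _]] := hB; have [_ [fcod _ _]] := fB.
have [_ [fNcod _ fNsur]] := fN.
exists (g \o h).
  split=> [x y Bx By /=|q]; first by rewrite hhB// hg//; apply: hcod.
  by have [x Bx <-] := sg q; exists (f x); rewrite /= ?hK//; apply: fcod.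
move=> y; split=> [/fNsur[x /kg[Bx gx] <-]|[By /= e]].
  by split; [exact: fcod | rewrite /= hK].
by rewrite -(fK _ By); apply/fNcod/kg; split=> //; apply: hcod.
Qed.

Lemma series_iso B B' s A A' (f : F -> F) : iso_on B B' f -> iso_on A A' f ->
  series B s A -> series B' s A'.
Proof.
elim: s B B' => [|S s IH] B B' fB fA /=.
  move=> eBA; apply: subgroup_ext => x.
  have [_ [fcB _ fsB]] := fB.
  have [_ [fcA _ fsA]] := fA.
  split=> [/fsB[y By <-]|/fsA[y Ay <-]]; first by apply: fcA; rewrite -eBA.
  by apply: fcB; rewrite eBA.
move=> [N sN sA]; have [N' eN' fN] := iso_on_sub fB (step_sub sN).
by exists N'; [exact: step_iso fB fN sN | exact: IH fN fA sA].
Qed.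

Lemma normal_inI L B N : normal_in L B -> N `<=` B -> normal_in (subgroupI L N) N.
Proof.
move=> [sL nL] sN; split; first by move=> x [].
by move=> x y Nx [Ly Ny]; split; [apply/nL => //; apply: sN | apply: subJ].
Qed.

(** As the image of [L] in a simple factor is trivial or everything, each factor of
    [B] either occurs in [L] or disappears. *)
Lemma series_inter B s A L : series B s A -> normal_in L B ->
  exists u, series L u (subgroupI L A).
Proof.
elim: s B L => [|S s IH] B L /=.
  move=> <- [sLB _]; exists [::] => /=; apply: subgroup_ext => x.
  by split=> [Lx|[]//]; split=> //; apply: sLB.
move=> [N [f ef kf] sA] nL; have sNB := kernel_sub kf.
have [u su] := IH _ _ sA (normal_inI nL sNB).
have eA : subgroupI (subgroupI L N) A = subgroupI L A.
  apply: subgroup_ext => x; split=> [[[]]//|[Lx Ax]]; split=> //; split=> //.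
  exact: series_sub sA _ Ax.
have [triv|epiL] := simple_image ef nL.
  have eL : subgroupI L N = L.
    apply: subgroup_ext => x; split=> [[]//|Lx]; split=> //.
    by apply/kf; split; [apply: nL.1 | apply: triv].
  by exists u; move: su; rewrite eA eL.
exists (S :: u) => /=; exists (subgroupI L N); last by rewrite -eA.
exists f => // x; split=> [[Lx /kf[_ e]]//|[Lx e]]; split=> //.
by apply/kf; split=> //; apply: nL.1.
Qed.

Lemma subgroupI_r L A : A `<=` L -> subgroupI L A = A.
Proof.
by move=> sAL; apply: subgroup_ext => x; split=> [[]//|Ax]; split=> //; apply: sAL.
Qed.

(** The product of [N1] and [N2] is a normal subgroup larger than [N1], so it is [B],
    and [B] has the same image modulo [N1] as [N2]. *)
Lemma step_inter B N1 N2 S T : step B N1 S -> step B N2 T -> N1 <> N2 ->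
  step N2 (subgroupI N2 N1) S.
Proof.
move=> s1 s2 neN; have nN2 := step_normal s2; have nN1 := step_normal s1.
have [f ef kf] := s1; have [g eg kg] := s2.
have [triv|epi2] := simple_image ef nN2.
  case: neN; have sub21 : N2 `<=` N1.
    by move=> x N2x; apply/kf; split; [apply: nN2.1 | apply: triv].
  have [triv'|[_ epi1]] := simple_image eg nN1.
    apply: subgroup_ext => x; split; last exact: sub21.
    by move=> N1x; apply/kg; split; [apply: nN1.1 | apply: triv'].
  (* [B = N1 * N2], so [N1] is everything, which a simple quotient forbids *)
  have /simpleP[/negP[]] := FS_simple S; apply/eqP/setP => q.
  rewrite !finset.inE; apply/esym/eqP; have [b Bb <-] := ef.2 q.
  have [a N1a ab] := epi1 (g b); have Ba := nN1.1 _ N1a.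
  have N2c : a^-1 * b \isin N2.
    apply/kg; split; first by apply: subM => //; apply: subV.
    by rewrite (homVM eg.1)// ab mulVg.
  have := triv _ N2c; rewrite (homVM ef.1)//.
  by have /kf[_ ->] := N1a; rewrite invg1 mul1g.
exists f => // x; split=> [[N2x /kf[_ e]]//|[N2x e]]; split=> //.
by apply/kf; split=> //; apply: nN2.1.
Qed.

(** If the top terms [N1] and [N2] differ, both series are compared with series
    through [N1 :&: N2]: by [step_inter] the two upper factors of the one through
    [N1] are, in the other order, those of the one through [N2]. *)
Theorem jordan_hoelder B s t A : series B s A -> series B t A -> perm_eq s t.
Proof.
have stepN N S : ~ step N N S.
  move=> [f [hf sf] kf]; have /simpleP[/negP[]] := FS_simple S.
  apply/eqP/setP => q; rewrite !finset.inE; apply/esym/eqP.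
  by have [b Nb <-] := sf q; have /kf[] := Nb.
have nil_series N S u X : step N X S -> series X u N -> False.
  move=> sX /series_sub sNX; apply: (@stepN N S).
  suff {2}-> : N = X by [].
  by apply: subgroup_ext => x; split=> [/sNX//|/(step_sub sX)].
move: {2}(size s) (leqnn (size s)) => n.
elim: n B s t => [|n IH] B [|S s] [|T t] //= sn.
- by move=> -> [N sN /(nil_series _ _ _ _ sN)].
- by move=> -> [N sN /(nil_series _ _ _ _ sN)].
- by move=> [N sN /[swap] <- /(nil_series _ _ _ _ sN)].
move=> [N1 s1 s1A] [N2 s2 s2A].
have [e|ne] := EM (N1 = N2).
  rewrite -{}e in s2 s2A; rewrite (step_uniq s1 s2) perm_cons.
  exact: IH s1A s2A.
have [u su] := series_inter s1A (normal_inI (step_normal s2) (step_sub s1)).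
have sAN2 := series_sub s2A.
have eI : subgroupI (subgroupI N2 N1) A = A.
  by apply: subgroupI_r => x Ax; split; [apply: sAN2 | apply: series_sub s1A _ Ax].
have eC : subgroupI N1 N2 = subgroupI N2 N1.
  by apply: subgroup_ext => x; split=> -[].
rewrite {}eI in su.
have ser1 : series N1 (T :: u) A.
  exists (subgroupI N2 N1) => //.
  by rewrite -eC; apply: step_inter s2 s1 _ => e; apply: ne.
have ser2 : series N2 (S :: u) A.
  by exists (subgroupI N2 N1) => //; apply: step_inter s1 s2 ne.
have p1 := IH _ _ _ sn s1A ser1.
have p2 : perm_eq (S :: u) t.
  by apply: IH ser2 s2A; rewrite -[size _](perm_size p1).
rewrite -(perm_cons S) in p1; apply: (perm_trans p1).
rewrite -(perm_cons T) in p2; apply: perm_trans p2.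
by apply/seq.permP => P /=; rewrite addnCA.
Qed.

End Factors.

(** * Existence of composition series and of normal cores *)

Section FiniteQuotients.
Local Open Scope group_scope.
Variable F : groupType.
Implicit Types (A B C N : subgroup F).

Lemma multiplicative1 (K K' : groupType) (f : {multiplicative K -> K'}) : f 1 = 1.
Proof. by apply: (mulgI (f 1)); rewrite -gmulfM !mulg1. Qed.

Lemma finite_indexS A B :
  A `<=` B -> finite_index A -> finite_index B.
Proof.
move=> sAB fA; pose h (X : set F) := left_coset B (xget 1 X).
apply: sub_finite_set (finite_image h fA) => _ [x _ <-].
exists (left_coset A x); first by exists x.
rewrite /h; apply/left_cosetP.
case: xgetP => [y _ [a Aa <-]|/(_ x)[]]; last first.
  by exists 1; rewrite ?mulg1//; apply: sub1.
by rewrite invgM -mulgA mulVg mulg1; apply/subV/sAB.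
Qed.

Lemma corestrict_image B (gT : finGroupType) (h : F -> gT) : hom_on B h ->
  exists (Q : finGroupType) (f : F -> Q),
    epi_on B f /\ forall x, x \isin B -> f x = 1 <-> h x = 1.
Proof.
move=> hh; have [G HP] := image_group hh.
have hG x : x \isin B -> h x \in G by move=> ?; apply/HP; exists x.
exists (subg_of G), (fun x => subg G (h x)); split; last first.
  move=> x Bx; split=> [e|->]; last exact: (morph1 (subg_morphism G)).
  by rewrite -(fingroup.subgK (h x) (hG x Bx)) e.
split=> [x y Bx By|q]; first by rewrite hh// (morphM (subg_morphism G))//; exact: hG.
by have /HP[x Bx e] := subgP q; exists x => //; rewrite e sgvalK.
Qed.

(** The action of [B] by translation on the left cosets of [N], which has the normal
    core of [N] as its kernel. *)
Lemma coset_quotient B N : N `<=` B -> finite_index N ->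
  exists (Q : finGroupType) (f : F -> Q), [/\ epi_on B f,
    (forall x, x \isin B -> f x = 1 -> x \isin N) &
    (normal_in N B -> is_kernel B f N)].
Proof.
move=> sNB fN.
have /finite_seqP[s sE] : finite_set [set left_coset N x | x in B].
  by apply: sub_finite_set fN => _ [x _ <-]; exists x.
have sP (X : set F) : reflect (exists2 x, x \isin B & left_coset N x = X) (X \in s).
  by apply: (iffP idP) => [Xs|BX]; have := congr1 (@^~ X) sE => /= e;
    [move: Xs; rewrite -e | move: BX; rewrite e].
(* inverses turn left translations into a right action, as [perm] requires *)
pose act b (X : set F) := left_coset X b^-1.
have actE b x : act b (left_coset N x) = left_coset N (b^-1 * x).
  apply/seteqP; split=> [_ [_ [a Na <-] <-]|_ [a Na <-]].
    by exists a; rewrite ?mulgA.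
  by exists (x * a); rewrite ?mulgA//; exists a.
have act_in b (X : seq_sub s) : b \isin B -> act b (val X) \in s.
  move=> Bb; have /sP[x Bx <-] := valP X; rewrite actE; apply/sP.
  by exists (b^-1 * x) => //; apply: subM => //; apply: subV.
pose t b (X : seq_sub s) := insubd X (act b (val X)).
have tE b X : b \isin B -> val (t b X) = act b (val X).
  by move=> Bb; rewrite val_insubd act_in.
have t_inj b : b \isin B -> injective (t b).
  move=> Bb X Y /(congr1 val); rewrite !tE// => e; apply: val_inj; move: e.
  have /sP[x Bx <-] := valP X; have /sP[y By <-] := valP Y.
  rewrite !actE => /left_cosetP; rewrite invgM invgK -mulgA mulKVg.
  by move=> ?; apply/left_cosetP.
pose h b : {perm seq_sub s} :=
  if pselect (injective (t b)) is left inj then perm inj else 1.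
have hE b X : b \isin B -> val (h b X) = act b (val X).
  move=> Bb; rewrite /h; case: pselect => [inj|[]]; last exact: t_inj.
  by rewrite permE tE.
have hM : hom_on B h.
  move=> x y Bx By; apply/perm.permP => X; apply: val_inj.
  rewrite permM !hE//; last exact: subM.
  by have /sP[z Bz <-] := valP X; rewrite !actE invgM mulgA.
have h1 x : x \isin B -> h x = 1 <->
    forall y, y \isin B -> subgroup_set N (y^-1 * x * y).
  move=> Bx; split=> [e y By|Nx].
    have ys : left_coset N y \in s by apply/sP; exists y.
    have := hE x (SeqSub ys) Bx; rewrite e perm1 /= actE => /left_cosetP.
    by move=> /subV; rewrite !invgM !invgK.
  apply/perm.permP => X; apply: val_inj; rewrite hE// perm1.
  have /sP[y By <-] := valP X; rewrite actE; apply/esym/left_cosetP.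
  by have /subV := Nx y By; rewrite !invgM !invgK !mulgA.
have [Q [f [ef f1]]] := corestrict_image hM; exists Q, f; split=> //.
  move=> x Bx /(f1 x Bx)/(h1 x Bx)/(_ _ (sub1 B)).
  by rewrite invg1 mul1g mulg1.
move=> nN x; split=> [Nx|[Bx]].
  have Bx := sNB _ Nx; split=> //; apply/f1 => //; apply/h1 => // y By.
  by have := nN.2 _ _ By Nx; rewrite /conjg mulgA.
move=> /(f1 x Bx)/(h1 x Bx)/(_ _ (sub1 B)).
by rewrite invg1 mul1g mulg1.
Qed.

Lemma normal_core C : finite_index C -> exists N,
  [/\ finite_index N, normal_in N (full_subgroup F) & N `<=` C].
Proof.
have sCT : C `<=` full_subgroup F by [].
move=> fC; have [Q [f [ef fC1 _]]] := coset_quotient sCT fC.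
have [N kN] := kernel_ex ef.1; exists N; split.
- exact: finite_index_ker ef.1 kN (finite_indexT F).
- exact: kernel_normal ef.1 kN.
- by move=> x /kN[_]; apply: fC1.
Qed.

(** A maximal normal subgroup of [Q] pulls back to the top term of a series. *)
Lemma kernel_series B (Q : finGroupType) (f : F -> Q) N : epi_on B f ->
  is_kernel B f N -> exists s, series B s N.
Proof.
move: {2}#|Q| (leqnn #|Q|) => n.
elim: n Q f B => [|n IH] Q f B.
  by rewrite leqn0 -cardsT => /eqP/cards0_eq/setP/(_ 1); rewrite !finset.inE.
move=> leQn ef kN; have [Q1|ntQ] := eqVneq [set: Q]%SET 1%SET.
  exists [::]; apply: subgroup_ext => x; rewrite (propext (kN x)).
  split=> [Bx|[]//]; split=> //; have : f x \in [set: Q]%SET by rewrite finset.inE.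
  by rewrite Q1 finset.inE => /eqP.
have [M maxM] := ex_maxnormal_ntrivg (ntQ : [set: Q]%G :!=: 1).
have nM : M <| [set: Q]%SET := maxnormal_normal maxM.
have simQ : simple [set: coset_of M]%SET.
  by rewrite -(quotientT M) quotient_simple.
have [S [iS _]] := FS_cover simQ.
have [h bh] := iS.
have NMT q : q \in 'N(M).
  by apply: (fintype.subsetP (normal_norm nM)); rewrite finset.inE.
have hM : hom_on B (fun x => h (coset M (f x))).
  move=> x y Bx By; rewrite ef.1// morphM ?NMT//; exact: gmulfM.
have sM k : exists2 x, x \isin B & h (coset M (f x)) = k.
  have [g hK gK] := bh; have [q Nq eq] := cosetP (g k).
  by have [x Bx xq] := ef.2 q; exists x; rewrite // xq -eq gK.
have [B' kB'] := kernel_ex hM.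
have B'E x : x \isin B' <-> x \isin B /\ f x \in M.
  split=> [/kB'[Bx e]|[Bx e]]; last first.
    by apply/kB'; split; rewrite // (coset_id e) multiplicative1.
  split=> //; apply: coset_idr; first exact: NMT.
  by apply: (bij_inj bh); rewrite e multiplicative1.
have ef' : epi_on B' (fun x => subg M (f x)).
  split=> [x y /B'E[Bx Mx] /B'E[By My]|q].
    by rewrite ef.1// (morphM (subg_morphism M)).
  have [x Bx e] := ef.2 (sgval q); have Mx : f x \in M by rewrite e subgP.
  by exists x; [apply/B'E | rewrite e sgvalK].
have kN' : is_kernel B' (fun x => subg M (f x)) N.
  move=> x; split=> [/kN[Bx e]|[/B'E[Bx Mx] e]].
    split; first by apply/B'E; split; rewrite // e group1.
    by rewrite e; exact: (morph1 (subg_morphism M)).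
  by apply/kN; split; rewrite // -(fingroup.subgK (f x) Mx) e.
have [|s ss] := IH _ _ B' _ ef' kN'.
  have cM : #|subg_of M| = #|M| by rewrite -cardsT (card_isog (isog_subg M)).
  rewrite cM -ltnS; apply: leq_trans leQn; rewrite -[#|Q|]cardsT.
  by apply: proper_card; case/maxgroupP: maxM => /andP[].
by exists (S :: s), B'; last by []; exists (fun x => h (coset M (f x))).
Qed.

Lemma normal_series B N : normal_in N B -> finite_index N ->
  exists s, series B s N.
Proof.
move=> nN fN; have [Q [f [ef _ /(_ nN) kN]]] := coset_quotient nN.1 fN.
exact: kernel_series ef kN.
Qed.

Lemma subnormal_series A : Defs.subnormal A -> finite_index A ->
  exists s, series (full_subgroup F) s A.
Proof.
move=> [l [C [<- <- nC]]] fA.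
have sub i d : (i + d <= l)%N -> C (i + d)%N `<=` C i.
  elim: d => [|d IH]; first by rewrite addn0 => x.
  by rewrite addnS => lt x Cx; apply: (IH (ltnW lt)); apply: (nC _ lt).1.
have {sub}fA i : (i <= l)%N -> finite_index (C i).
  move=> leil; apply: finite_indexS fA; rewrite -(subnKC leil).
  by apply: sub; rewrite subnKC.
elim: l nC fA => [|l IH] nC fA; first by exists [::].
have [||s ss] := IH; first by move=> i /ltnW; apply: nC.
  by move=> i /leqW; apply: fA.
have [t st] := normal_series (nC l (ltnSn l)) (fA _ (leqnn _)).
by exists (s ++ t); apply: series_cat ss st.
Qed.

Lemma series_subnormal A s : series (full_subgroup F) s A -> Defs.subnormal A.
Proof.
move=> ss; suff [l [C [C0 Cl nC]]] : exists (l : nat) (C : nat -> subgroup F),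
    [/\ C 0%N = full_subgroup F, C l = A &
        forall i, (i < l)%N -> normal_in (C i.+1) (C i)] by exists l, C.
elim: s (full_subgroup F) ss => [|S s IH] B /=.
  by move=> <-; exists 0%N, (fun=> B).
move=> [N sN /IH[l [C [C0 Cl nC]]]].
exists l.+1, (fun i => if i is j.+1 then C j else B); split=> //.
by move=> [|i] lti /=; [rewrite C0; apply: step_normal sN | apply: nC].
Qed.

End FiniteQuotients.

(** * Automorphisms of free groups act transitively on epimorphisms *)

Section FreeSubgroups.
Local Open Scope group_scope.
Variable F : groupType.
Implicit Types (A B : subgroup F).

(** The universal property of [free_basis] for a subgroup, with uniqueness of the
    extensions replaced by the equivalent condition that the basis generates. *)
Definition free_on A (I : Type) (x : I -> F) : Prop :=
  [/\ forall i, x i \isin A,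
      forall B, (forall i, x i \isin B) -> A `<=` B &
      forall (K : groupType) (k : I -> K),
        exists2 f : F -> K, hom_on A f & forall i, f (x i) = k i].

(** Homomorphisms into a subgroup and into the whole group are compared to see
    that a basis generates. *)
Lemma free_basis_on n (x : 'I_n -> F) :
  free_basis x -> free_on (full_subgroup F) x.
Proof.
move=> fx; split=> // [B Bx a _|K k]; last first.
  by have [f fE _] := fx K k; exists f => // y z _ _; apply: gmulfM.
pose xB i : subgroup_type B := Sub (x i) (mem_set (Bx i)).
have [f fE _] := fx (subgroup_type B) xB.
have vM : {morph (fun a => val (f a)) : y z / y * z}.
  by move=> y z; rewrite gmulfM.
pose vm := isMultiplicative.Build F F (fun a => val (f a)) vM.
pose v : {multiplicative F -> F} := HB.pack (fun a => val (f a)) vm.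
pose im := isMultiplicative.Build F F (@idfun F) (fun y z => erefl).
pose i : {multiplicative F -> F} := HB.pack (@idfun F) im.
have [h _ hU] := fx F x.
have ve : v =1 h by apply: hU => j /=; rewrite fE.
have ie : i =1 h by apply: hU.
have -> : a = v a by rewrite ve -ie.
exact/set_mem/(valP (f a)).
Qed.

Lemma free_hom_eq A I (x : I -> F) (K : groupType) (f g : F -> K) :
    free_on A x -> hom_on A f -> hom_on A g -> (forall i, f (x i) = g (x i)) ->
  forall a, a \isin A -> f a = g a.
Proof.
move=> [Ax gx _] hf hg e a Aa.
by have [] : a \isin Subgroup (equalizer_subgroup hf hg) by apply: gx Aa => i; split.
Qed.

Lemma free_reindex A I J (x : I -> F) (s : J -> I) :
  bijective s -> free_on A x -> free_on A (x \o s).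
Proof.
move=> [t sK tK] [Ax gx ux]; split.
- by move=> j; apply: Ax.
- by move=> B Bx; apply: gx => i; rewrite -(tK i); apply: Bx.
- by move=> K k; have [f hf fE] := ux K (k \o t); exists f => // j; rewrite fE/= sK.
Qed.

(** The word map [x j |-> x j * u j], for [j] in [J] and [u j] a word in the other
    basis elements, is inverted by [x j |-> x j * (u j)^-1]. *)
Lemma free_transvection A (I : finType) (x u y : I -> F) (J : {set I}) :
    free_on A x ->
    (forall j, j \in J -> forall B, (forall i, i \notin J -> x i \isin B) ->
       u j \isin B) ->
    (forall j, y j = if j \in J then x j * u j else x j) ->
  free_on A y.
Proof.
move=> [Ax gx ux] uJ yE.
have Au j : j \in J -> u j \isin A by move=> /uJ; apply.
split.
- by move=> j; rewrite yE; case: ifP => // jJ; apply: subM => //; apply: Au.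
- move=> B By; apply: gx.
  have Bx i : i \notin J -> x i \isin B.
    by move=> iJ; have := By i; rewrite yE (negPf iJ).
  move=> j; have [jJ|] := boolP (j \in J); last exact: Bx.
  have := By j; rewrite yE jJ => Bxu; rewrite -(mulgK (u j) (x j)).
  by apply: subF => //; apply: uJ.
- move=> K k; have [g hg gE] := ux K k.
  have [f hf fE] := ux K (fun j => if j \in J then k j * (g (u j))^-1 else k j).
  exists f => // j; rewrite yE; have [jJ|jJ] := boolP (j \in J); last first.
    by rewrite fE (negPf jJ).
  rewrite hf//; last exact: Au.
  have [_ /= ->] : u j \isin Subgroup (equalizer_subgroup hf hg).
    by apply: uJ => // i iJ; split=> //=; rewrite fE gE (negPf iJ).
  by rewrite fE jJ mulgKV.
Qed.

Definition generates (S : finGroupType) (I : finType) (P : {set I}) (v : I -> S) :=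
  forall H : {group S}, (forall i, i \in P -> v i \in H) -> forall q, q \in H.

Lemma lift_word A (I : finType) (x : I -> F) (S : finGroupType) (f : F -> S)
    (P : {set I}) : free_on A x -> hom_on A f -> generates P (f \o x) ->
  forall q, exists2 u, f u = q &
    forall B, (forall i, i \in P -> x i \isin B) -> u \isin B.
Proof.
move=> [Ax gx _] hf gP q.
pose W u := forall B, (forall i, i \in P -> x i \isin B) -> u \isin B.
have sW : is_subgroup [set u | W u].
  apply/is_subgroupP; split=> [B _|u v Wu Wv B Bx]; first exact: sub1.
  by apply: subF; [apply: Wu | apply: Wv].
have hW : hom_on (Subgroup sW) f by apply: sub_hom hf => u; apply.
have [H HP] := image_group hW.
suff /HP[u Wu fu] : q \in H by exists u.
by apply: gP => i iP; apply/HP; exists (x i) => // B; apply.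
Qed.

Lemma epi_generates A (I : finType) (x : I -> F) (S : finGroupType) (f : F -> S) :
  free_on A x -> epi_on A f -> generates [set: I]%SET (f \o x).
Proof.
move=> [Ax gx _] [hf sf] H Hx q; have [a Aa <-] := sf q.
have sB : is_subgroup (A `&` [set y | f y \in H]).
  apply: (@preim_is_subgroup F A S f (fun y => y \in H)) => //.
  by move=> y z Hy Hz; rewrite groupM// groupV.
have [] // : a \isin Subgroup sB.
by apply: gx Aa => i; split=> //=; apply: (Hx i); rewrite finset.inE.
Qed.

(** Every element of [S] is the value of a word in the [x i] with [i] outside [J], so
    a transvection corrects the value of [f] at each [x j] with [j] in [J]. *)
Lemma free_retarget A (I : finType) (x : I -> F) (S : finGroupType) (f : F -> S)
    (J : {set I}) (v : I -> S) :
    free_on A x -> hom_on A f -> generates (~: J)%SET (f \o x) ->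
    (forall i, i \notin J -> f (x i) = v i) ->
  exists2 y : I -> F, free_on A y & forall i, f (y i) = v i.
Proof.
move=> fx hf gJ vE; have [Ax _ _] := fx.
pose W j u := f u = (f (x j))^-1 * v j /\
  forall B, (forall i, i \notin J -> x i \isin B) -> u \isin B.
have /choice[u uP] : forall j, exists u, W j u.
  move=> j; have [u eu Wu] := lift_word fx hf gJ ((f (x j))^-1 * v j).
  by exists u; split=> // B Bx; apply: Wu => i; rewrite finset.inE; apply: Bx.
pose y j := if j \in J then x j * u j else x j.
exists y.
  by apply: (free_transvection fx (J := J) (u := u)) => // j _; have [] := uP j.
move=> j; rewrite /y; have [jJ|jJ] := boolP (j \in J); last exact: vE.
have [eu Wu] := uP j; rewrite hf//; last by apply: Wu.
by rewrite eu mulKVg.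
Qed.

(** Room for rewriting a basis: [b] superfluous members of a generating family can be
    replaced by a family [w] that generates [S] by itself. *)
Definition redundant (I : finType) (S : finGroupType) (b : nat) : Prop :=
  (exists w : 'I_b -> S, generates [set: 'I_b]%SET w) /\
  forall v : I -> S, generates [set: I]%SET v ->
    exists2 J : {set I}, #|J| = b & generates (~: J)%SET v.

Lemma generatesS (S : finGroupType) (I J : finType) (P : {set I}) (Q : {set J})
    (v : I -> S) (w : J -> S) :
  generates P v -> (forall i, i \in P -> exists2 j, j \in Q & w j = v i) ->
  generates Q w.
Proof.
by move=> gv vw H Hw; apply: gv => i /vw[j jQ <-]; apply: Hw.
Qed.

Lemma redundant_large (I : finType) (S : finGroupType) :
  (2 * #|S| <= #|I|)%N -> redundant I S #|S|.
Proof.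
move=> le2; split.
  exists (@enum_val S S) => H Hw q.
  by rewrite -(enum_rankK q); apply: Hw; rewrite finset.inE.
move=> v gv.
(* one index for each value taken by [v] *)
pose r q := [pick i | v i == q].
pose R := [set i | r (v i) == Some i]%SET.
have cR : (#|R| <= #|S|)%N.
  rewrite -(card_in_imset (f := v)); first exact: max_card.
  move=> i j; rewrite !finset.inE => /eqP ri /eqP rj e.
  by apply: Some_inj; rewrite -ri -rj e.
have gR : generates R v.
  apply: (generatesS gv) => i _; case e : (r (v i)) => [j|]; last first.
    by move: e; rewrite /r; case: pickP => // /(_ i); rewrite eqxx.
  have vj : v j = v i by move: e; rewrite /r; case: pickP => // k /eqP ? [<-].
  by exists j; rewrite // finset.inE vj e.
have /card_geqP[s [us ss sJ]] : (#|S| <= #|(~: R)%SET|)%N.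
  have := cardsC R; lia.
exists [set i in s]%SET; first by rewrite cardsE (card_uniqP us).
apply: (generatesS gR) => i iR; exists i => //.
by rewrite finset.in_setC finset.inE; apply/negP => /sJ; rewrite finset.in_setC iR.
Qed.

Lemma prime_generated (S : finGroupType) (q : S) : prime #|S| -> q != 1 ->
  forall H : {group S}, q \in H -> forall r, r \in H.
Proof.
move=> pS nq H Hq r; suff -> : H = [set: S]%G by rewrite finset.inE.
apply/val_inj/eqP; rewrite eqEcard finset.subsetT /= cardsT.
have := cardSg (finset.subsetT H : H \subset [set: S]%G).
rewrite cardsT => /(primeP pS).2 /orP[|/eqP-> //].
by rewrite -trivg_card1 => /eqP H1; move: Hq nq; rewrite H1 finset.inE => ->.
Qed.

Lemma prime_nontrivial (S : finGroupType) : prime #|S| -> exists q : S, q != 1.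
Proof.
move=> pS; have [q _ nq] : exists2 q : S, q \in [set: S]%SET & q != 1.
  by apply/trivgPn; rewrite trivg_card1 cardsT; case: eqP pS => // ->.
by exists q.
Qed.

(** For a group of prime order, rank two is enough whatever the order. *)
Lemma redundant_prime (I : finType) (S : finGroupType) :
  prime #|S| -> (2 <= #|I|)%N -> redundant I S 1.
Proof.
move=> pS ge2; split.
  have [q nq] := prime_nontrivial pS.
  exists (fun=> q) => H Hw; apply: (prime_generated pS nq).
  by apply: (Hw ord0); rewrite finset.inE.
move=> v gv; have [i vi] : exists i, v i != 1.
  apply/existsP; apply: contraT => /existsPn v1.
  have : #|[set: S]%SET| = 1%N.
    apply/eqP; rewrite -trivg_card1; apply/eqP/trivgP/fintype.subsetP => q _.
    by apply: (gv 1%G) => i _; have := v1 i; rewrite negbK finset.inE.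
  by rewrite cardsT => S1; rewrite S1 in pS.
have [j ji] : exists j, j != i.
  apply/existsP; apply: contraT => /existsPn all_i; move: ge2.
  suff /eqP-> : #|I| == 1%N by [].
  by apply/fintype1P; exists i => j; apply/eqP; rewrite -[_ == _]negbK all_i.
exists [set j]%SET; first by rewrite cards1.
move=> H Hv; apply: (prime_generated pS vi); apply: Hv.
by rewrite !finset.inE eq_sym.
Qed.

(** Two rounds of retargeting make the values of [f] equal to [w, 1, ..., 1]: first the
    superfluous members become [w], which makes all the other ones superfluous. *)
Lemma free_standard_basis A (I : finType) (x : I -> F) (S : finGroupType) (b : nat)
    (w : 'I_b -> S) (f : F -> S) (J : {set I}) :
    free_on A x -> hom_on A f -> #|J| = b -> generates [set: 'I_b]%SET w ->
    generates (~: J)%SET (f \o x) ->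
  exists2 y : 'I_b + 'I_(#|I| - b) -> F, free_on A y &
    forall z, f (y z) = if z is inl k then w k else 1.
Proof.
move=> fx hf cJ gw gJ.
have cJC : #|(~: J)%SET| = (#|I| - b)%N by have := cardsC J; lia.
pose s (z : 'I_b + 'I_(#|I| - b)) := match z with
  | inl k => enum_val (cast_ord (esym cJ) k)
  | inr k => enum_val (cast_ord (esym cJC) k) end.
have sJ z : (s z \in J) = if z is inl _ then true else false.
  case: z => k /=; first exact: enum_valP.
  by apply/negbTE; have := enum_valP (cast_ord (esym cJC) k); rewrite finset.in_setC.
have s_inj : injective s.
  move=> [k|k] [l|l] e.
  - by move: e => /enum_val_inj/cast_ord_inj->.
  - by have := sJ (inl k); rewrite e sJ.
  - by have := sJ (inl l); rewrite -e sJ.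
  - by move: e => /enum_val_inj/cast_ord_inj->.
have bs : bijective s.
  apply: inj_card_bij => //; rewrite card_sum !card_ord.
  by have := cardsC J; lia.
have fxs := free_reindex bs fx; have [t sK tK] := bs.
pose L := [set z : 'I_b + 'I_(#|I| - b) | if z is inl _ then true else false]%SET.
pose v1 z := if z is inl k then w k else f (x (s z)).
have [|i|x1 fx1 x1E] := @free_retarget A _ (x \o s) S f L v1 fxs hf.
- apply: (generatesS gJ) => i; rewrite finset.in_setC -{1}(tK i) sJ => iJ.
  by exists (t i); rewrite /= ?tK// finset.in_setC finset.inE.
- by rewrite finset.inE; case: i.
pose v2 (z : 'I_b + 'I_(#|I| - b)) := if z is inl k then w k else 1.
have [|i|x2 fx2 x2E] := @free_retarget A _ x1 S f (~: L)%SET v2 fx1 hf.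
- apply: (generatesS gw) => k _; exists (inl k); last by rewrite /= x1E.
  by rewrite !finset.in_setC negbK finset.inE.
- by rewrite finset.in_setC negbK finset.inE x1E; case: i.
by exists x2.
Qed.

Lemma free_change_basis A (I : Type) (x y : I -> F) :
  free_on A x -> free_on A y ->
  exists2 g : F -> F, iso_on A A g & forall i, g (x i) = y i.
Proof.
move=> fx fy; have [Ax gx ux] := fx; have [Ay gy uy] := fy.
have stab (u v : I -> F) (h : F -> F) : free_on A u -> (forall i, v i \isin A) ->
    hom_on A h -> (forall i, h (u i) = v i) -> forall a, a \isin A -> h a \isin A.
  move=> [Au gu _] Av hh hE a Aa.
  have sB := @preim_is_subgroup F A F h (fun y => y \isin A) hh (sub1 A) (@subF F A).
  have [] // : a \isin Subgroup sB.
  by apply: gu Aa => i; split=> //=; rewrite hE.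
have [g hg gE] := ux F y; have [h hh hE] := uy F x.
have gA := stab x y g fx Ay hg gE; have hA := stab y x h fy Ax hh hE.
have hg_hom : hom_on A (h \o g).
  by move=> a b Aa Ab /=; rewrite hg// hh//; apply: gA.
have gh_hom : hom_on A (g \o h).
  by move=> a b Aa Ab /=; rewrite hh// hg//; apply: hA.
have gK a : a \isin A -> h (g a) = a.
  by move=> Aa; apply: (free_hom_eq fx hg_hom (g := idfun)) => // i /=; rewrite gE hE.
have hK a : a \isin A -> g (h a) = a.
  by move=> Aa; apply: (free_hom_eq fy gh_hom (g := idfun)) => // i /=; rewrite hE gE.
exists g => //; apply: iso_onP => //.
  by move=> a Aa e; rewrite -(gK a Aa) e (hom1 hh).
by move=> a Aa; exists (h a); [apply: hA | apply: hK].
Qed.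

(** Some bases of [A] have the same values under [f] and under [g]; the automorphism
    exchanges them. *)
Theorem aut_transitive A (I : finType) (x : I -> F) (S : finGroupType) (b : nat)
    (f g : F -> S) :
    free_on A x -> redundant I S b -> epi_on A f -> epi_on A g ->
  exists2 h : F -> F, iso_on A A h & forall a, a \isin A -> g (h a) = f a.
Proof.
move=> fx [[w gw] rJ] ef eg.
have [J cJ gJ] := rJ _ (epi_generates fx ef).
have [L cL gL] := rJ _ (epi_generates fx eg).
have [y fy yE] := free_standard_basis fx ef.1 cJ gw gJ.
have [z fz zE] := free_standard_basis fx eg.1 cL gw gL.
have [h ih hE] := free_change_basis fy fz; exists h => // a Aa.
have [hh [hA _ _]] := ih.
apply: (free_hom_eq fy (f := g \o h) _ ef.1) => // [c d Ac Ad|i] /=.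
  by rewrite hh// eg.1//; apply: hA.
by rewrite hE yE zE.
Qed.

End FreeSubgroups.

(** * Kernels of maps from a free group to a finite group are free *)

(** The wreath product of [K] by the right regular action of [Q]. A map into it with
    second component [f] is a cocycle with values in [K], and the value of a cocycle
    at [1] is a homomorphism on the kernel of [f]. *)
Definition wreath (Q K : groupType) : Type := ((Q -> K) * Q)%type.

HB.instance Definition _ (Q K : groupType) := gen_eqMixin (wreath Q K).
HB.instance Definition _ (Q K : groupType) := gen_choiceMixin (wreath Q K).

Section Wreath.
Local Open Scope group_scope.
Variables Q K : groupType.
Implicit Types u v w : wreath Q K.

Definition wreath_mul u v : wreath Q K := (fun c => u.1 c * v.1 (c * u.2), u.2 * v.2).
Definition wreath_inv u : wreath Q K := (fun c => (u.1 (c * u.2^-1))^-1, u.2^-1).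
Definition wreath_one : wreath Q K := (fun=> 1, 1).

Fact wreath_mulA : associative wreath_mul.
Proof.
move=> u v w; congr pair; rewrite /= ?mulgA//.
by apply/funext => c /=; rewrite !mulgA.
Qed.

Fact wreath_mul1g : left_id wreath_one wreath_mul.
Proof.
move=> [u q]; congr pair; rewrite /= ?mul1g//.
by apply/funext => c /=; rewrite mul1g mulg1.
Qed.

Fact wreath_mulg1 : right_id wreath_one wreath_mul.
Proof.
move=> [u q]; congr pair; rewrite /= ?mulg1//.
by apply/funext => c /=; rewrite mulg1.
Qed.

Fact wreath_mulVg : left_inverse wreath_one wreath_inv wreath_mul.
Proof.
move=> [u q]; congr pair; rewrite /= ?mulVg//.
by apply/funext => c /=; rewrite mulVg.
Qed.

Fact wreath_mulgV : right_inverse wreath_one wreath_inv wreath_mul.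
Proof.
move=> [u q]; congr pair; rewrite /= ?mulgV//.
by apply/funext => c /=; rewrite mulgK mulgV.
Qed.

HB.instance Definition _ := isGroup.Build (wreath Q K)
  wreath_mulA wreath_mul1g wreath_mulg1 wreath_mulVg wreath_mulgV.

Lemma wreath_mulE u v :
  u * v = (fun c => u.1 c * v.1 (c * u.2), u.2 * v.2) :> wreath Q K.
Proof. by []. Qed.

End Wreath.

Section Schreier.
Local Open Scope group_scope.
Variables (F : groupType) (A : subgroup F) (I : finType) (x : I -> F).
Variables (Q : finGroupType) (f : F -> Q).
Hypotheses (fx : free_on A x) (ef : epi_on A f).
Implicit Types (K : groupType) (c d : Q) (i : I) (e : Q * I) (t : Q -> F).

Definition cocycle K (phi : F -> Q -> K) : Prop :=
  forall a b c, a \isin A -> b \isin A ->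
    phi (a * b) c = phi a c * phi b (c * f a).

Lemma cocycle1 K (phi : F -> Q -> K) c : cocycle phi -> phi 1 c = 1.
Proof.
move=> cphi; apply: (mulgI (phi 1 c)).
have := cphi 1 1 c (sub1 A) (sub1 A).
by rewrite (hom1 ef.1) !mulg1 => <-.
Qed.

Lemma cocycleV K (phi : F -> Q -> K) a c : cocycle phi -> a \isin A ->
  phi a^-1 (c * f a) = (phi a c)^-1.
Proof.
move=> cphi Aa; apply: (mulgI (phi a c)).
by rewrite -cphi ?mulgV ?cocycle1//; apply: subV.
Qed.

(** A pair [(c, i)] is an edge of the Cayley graph of [Q], with origin [c]. *)
Let target e : Q := e.1 * f (x e.2).

(** [E] is the edge set of a tree with vertex set [V] containing [1], and [t c] is
    the word read along the path of that tree from [1] to [c]. The last clause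
    stands for an induction along this path. *)
Definition schreier_tree (E : {set Q * I}) (V : {set Q}) t : Prop :=
  [/\ 1 \in V /\ t 1 = 1,
      forall c, c \in V -> t c \isin A /\ f (t c) = c,
      forall e, e \in E -> [/\ e.1 \in V, target e \in V &
                             t e.1 * x e.2 = t (target e)] &
      forall K (phi : F -> Q -> K), cocycle phi ->
        (forall e, e \in E -> phi (x e.2) e.1 = 1) ->
        forall c, c \in V -> phi (t c) 1 = 1].

(** A set of vertices without crossing edges is stable under all of [Q]. *)
Lemma crossing_edge (V : {set Q}) : 1 \in V -> V != [set: Q]%SET ->
  exists e, (e.1 \in V) != (target e \in V).
Proof.
move=> V1 VT; apply/existsP; apply: contraT => /existsPn closed.
case/negP: VT; apply/eqP/setP => q; rewrite !finset.inE.
have [_ gx _] := fx; have [a Aa <-] := ef.2 q.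
have sB : is_subgroup (A `&` [set a | forall c, (c \in V) = (c * f a \in V)]).
  apply: (@preim_is_subgroup F A Q f
    (fun r => forall c, (c \in V) = (c * r \in V)) ef.1) => [c|r r' Vr Vr' c].
    by rewrite mulg1.
  by rewrite Vr [RHS]Vr' mulgA mulgKV.
have [_ /(_ 1)] : a \isin Subgroup sB.
  apply: gx Aa => i; have [Ax _ _] := fx; split=> //= c.
  by apply/eqP; have := closed (c, i); rewrite negbK.
by rewrite mul1g V1.
Qed.

Lemma grow_tree j : (j < #|Q|)%N -> exists E V t,
  [/\ schreier_tree E V t, #|V| = j.+1 & #|E| = j].
Proof.
have [Ax _ _] := fx.
elim: j => [_|j IH ltj].
  exists finset.set0, [set 1]%SET, (fun=> 1); rewrite cards1 cards0; split=> //.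
  split.
  - by rewrite finset.inE.
  - by move=> c; rewrite finset.inE => /eqP->; split; [apply: sub1 | apply: hom1 ef.1].
  - by move=> e; rewrite finset.inE.
  - by move=> K phi cphi _ c _; apply: cocycle1.
have [E [V [t [[[V1 t1] tP EP phiP] cV cE]]]] := IH (ltnW ltj).
have VT : V != [set: Q]%SET.
  by apply: contraTneq ltj => VT; rewrite -leqNgt -cV VT cardsT.
have [e eV] := crossing_edge V1 VT.
have eE : e \notin E by apply: contra eV => /EP[-> ->].
(* the new vertex [d] and the word [a] leading to it *)
suff [d [a [dV Aa fa [Ve Vt ta] phia]]] : exists d a, [/\ d \notin V, a \isin A,
    f a = d,
    [/\ e.1 \in d |: V, target e \in d |: V &
     (if e.1 == d then a else t e.1) * x e.2 =
     (if target e == d then a else t (target e))] &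
    forall K (phi : F -> Q -> K), cocycle phi -> phi (x e.2) e.1 = 1 ->
      (forall c, c \in V -> phi (t c) 1 = 1) -> phi a 1 = 1]%SET.
  have nd c : c \in V -> c == d = false.
    by move=> cV'; apply: contraNF dV => /eqP<-.
  exists (e |: E)%SET, (d |: V)%SET, (fun c => if c == d then a else t c).
  split; [ | by rewrite finset.cardsU1 dV cV | by rewrite finset.cardsU1 eE cE].
  split.
  - by split; [rewrite finset.inE V1 orbT | rewrite nd].
  - move=> c; rewrite !finset.inE; have [->//|_ /= /tP//] := eqVneq c d.
  - move=> e'; rewrite finset.in_setU1 => /orP[/eqP->//|/EP[V1' V2' tE]].
    by split; rewrite ?finset.inE ?V1' ?V2' ?orbT// !nd.
  - move=> K phi cphi phiE c; rewrite !finset.inE.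
    have phiV c' : c' \in V -> phi (t c') 1 = 1.
      by apply: phiP => // e' e'E; apply: phiE; rewrite finset.inE e'E orbT.
    have [_ _|_ /=] := eqVneq c d; last exact: phiV.
    by apply: phia => //; apply: phiE; exact: finset.setU11.
have [e1V|e1V] := boolP (e.1 \in V).
  have te : target e \notin V by move: eV; rewrite e1V; case: (target e \in V).
  have [Ae fe] := tP _ e1V.
  have ne : e.1 == target e = false by apply: contraNF te => /eqP<-.
  exists (target e), (t e.1 * x e.2); split=> //.
  - exact: subM.
  - by rewrite ef.1// fe.
  - by rewrite !finset.inE e1V orbT eqxx ne.
  - by move=> K phi cphi phie phiV; rewrite cphi// phiV// mul1g fe mul1g.
have te : target e \in V by move: eV; rewrite (negPf e1V); case: (target e \in V).
have [Ae fe] := tP _ te.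
have ne : target e == e.1 = false by apply: contraNF e1V => /eqP<-.
exists e.1, (t (target e) * (x e.2)^-1); split=> //.
- exact: subF.
- by rewrite ef.1// ?(homV ef.1)// ?fe ?mulgK//; apply: subV.
- by rewrite !finset.inE te orbT eqxx ne mulgKV.
- move=> K phi cphi phie phiV; rewrite cphi//; last exact: subV.
  by rewrite phiV// mul1g fe mul1g /target cocycleV// phie invg1.
Qed.

(** The Nielsen-Schreier theorem for a normal subgroup of finite index. The basis
    consists of the elements [t c * x i * (t (c * f (x i)))^-1] for the edges
    [(c, i)] outside a spanning tree, and maps out of it are induced by maps of
    [A] into a wreath product. *)
Theorem schreier (N : subgroup F) : is_kernel A f N -> exists m (y : 'I_m -> F),
  free_on N y /\ (m + #|Q| = #|Q| * #|I| + 1)%N.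
Proof.
move=> kN; have Q0 : (0 < #|Q|)%N by rewrite -cardsT cardG_gt0.
have [E [V [t [[[V1 t1] tP EP phiP] cV cE]]]] : exists E V t,
    [/\ schreier_tree E V t, #|V| = #|Q|.-1.+1 & #|E| = #|Q|.-1].
  by apply: grow_tree; rewrite prednK.
have VT c : c \in V.
  suff -> : V = [set: Q]%SET by rewrite finset.inE.
  by apply/eqP; rewrite eqEcard finset.subsetT cardsT cV (prednK Q0) leqnn.
have At c : t c \isin A by have [] := tP c (VT c).
have ft c : f (t c) = c by have [] := tP c (VT c).
have [Ax gx ux] := fx; have [hf _] := ef.
pose y e := t e.1 * x e.2 * (t (target e))^-1.
have Ny e : y e \isin N.
  apply/kN; split; first by apply: subF => //; apply: subM.
  by rewrite hf ?(homV hf) ?hf ?ft ?mulgV//; [apply: subM | apply: subV].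
have yE e : e \in E -> y e = 1 by move=> /EP[_ _ tE]; rewrite /y tE mulgV.
pose Y := {e | e \notin E}.
have fy : free_on N (fun z : Y => y (val z)).
  split=> [z //|B By a /kN[Aa fa]|K k].
    have {}By e : y e \isin B.
      have [/yE->|eE] := boolP (e \in E); first exact: sub1.
      exact: (By (exist _ e eE)).
    pose P a := forall c, t c * a * (t (c * f a))^-1 \isin B.
    have sC : is_subgroup (A `&` [set a | P a]).
      apply/is_subgroupP; split.
        split=> [|c] /=; first exact: sub1.
        by rewrite (hom1 hf) !mulg1 mulgV; apply: sub1.
      move=> b d [Ab Pb] [Ad Pd]; split=> [|c]; first exact: subF.
      have fbd : f (b * d^-1) = f b * (f d)^-1.
        by rewrite hf ?(homV hf)//; apply: subV.
      have := subF (Pb c) (Pd (c * f (b * d^-1))).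
      rewrite fbd -!mulgA mulVg mulg1 !invgM !invgK.
      by rewrite !mulgA mulgKV.
    have [_ /(_ 1)] : a \isin Subgroup sC.
      by apply: gx Aa => i; split=> //= c; apply: (By (c, i)).
    by rewrite fa mulg1 t1 mul1g invg1 mulg1.
  pose k' e := if insub e is Some z then k (z : Y) else 1.
  have [h hh hE] := ux (wreath Q K) (fun i => (fun c => k' (c, i), f (x i))).
  pose phi a c := (h a).1 c.
  have h2 a : a \isin A -> (h a).2 = f a.
    apply: (free_hom_eq fx (f := fun a => (h a).2) _ hf) => [b d Ab Ad|i].
      by rewrite hh.
    by rewrite hE.
  have cphi : cocycle phi by move=> a b c Aa Ab; rewrite /phi hh// wreath_mulE /= h2.
  have phit c : phi (t c) 1 = 1.
    apply: (phiP K phi cphi) => // e eE.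
    by rewrite /phi hE /= /k' -surjective_pairing insubN ?negbK.
  exists (fun a => phi a 1) => [a b /kN[Aa fa] /kN[Ab _]|z].
    by rewrite cphi// fa mulg1.
  have td1 d : phi (t d)^-1 d = 1.
    by have := cocycleV 1 cphi (At d); rewrite mul1g ft phit invg1.
  rewrite /y cphi; [|exact: subM|exact: subV].
  rewrite cphi// hf// !mul1g ft phit mul1g td1 mulg1.
  by rewrite /phi hE /= -surjective_pairing /k' valK.
exists #|{: Y}|, (fun j => y (val (enum_val j))); split.
  apply: (free_reindex (s := enum_val)) fy.
  by exists enum_rank; [apply: enum_valK | apply: enum_rankK].
rewrite card_sig; have := cardC (mem E); rewrite cE card_prod.
have -> : #|[predC (mem E)]| = #|[pred e | e \notin E]| by [].
by move=> eQ; rewrite addn1 -eQ -addSn (prednK Q0) addnC.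
Qed.

End Schreier.

(** * Subgroups with the same composition factors are related by [AComm] *)

Section AComm.
Local Open Scope group_scope.
Variable F : groupType.
Implicit Types (A B D N X Y Z : subgroup F) (S T : FS) (phi psi chi : viso F).

Lemma AComm_subgroup : is_subgroup (AComm F).
Proof.
apply/is_subgroupP; split.
  by move=> M [/is_subgroupP[M1 _] _].
move=> x y Ax Ay M /[dup] sM [/is_subgroupP[_ MF] _].
  by apply: MF; [apply: Ax | apply: Ay].
Qed.

Let AC := Subgroup AComm_subgroup.

Lemma aut_AComm phi : vdom phi = vcod phi -> AComm F (comm_class phi).
Proof.
move=> e M [_]; apply; exists (vdom phi); first exact: vdom_index.
by exists phi.
Qed.

Lemma viso_iso_on phi : iso_on (vdom phi) (vcod phi) phi.
Proof.
split; last exact: vfun_bij.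
by move=> x y Ax Ay; apply: vfunM.
Qed.

Lemma iso_on_viso A B (f : F -> F) : finite_index A -> finite_index B ->
  iso_on A B f -> exists phi, [/\ vdom phi = A, vcod phi = B & vfun phi = f].
Proof.
move=> fA fB [hf bf].
have mf : {in subgroup_set A &, {morph f : x y / x * y}}.
  by move=> x y /set_mem Ax /set_mem Ay; apply: hf.
by exists (Viso fA fB bf mf).
Qed.

Lemma comm_class_comp phi psi chi :
    (forall x, x \isin vdom chi -> x \isin vdom phi -> chi x = psi (phi x)) ->
  comm_class chi = comm_class psi * comm_class phi.
Proof.
move=> e; rewrite [RHS](comm_mulE phi psi); apply/comm_classP/viso_agreeI.
by move=> x cx [/= dx _]; apply: e.
Qed.

Lemma comm_class_restrict phi psi :
    (forall x, x \isin vdom psi -> x \isin vdom phi -> psi x = phi x) ->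
  comm_class psi = comm_class phi.
Proof. by move=> e; apply/comm_classP/viso_agreeI. Qed.

Lemma image_finite_index A B X Y (f : F -> F) :
  finite_index A -> finite_index B -> iso_on A B f ->
  X `<=` A -> iso_on X Y f -> finite_index X -> finite_index Y.
Proof.
move=> fA fB fAB sXA [_ [XY _ sYX]] fX.
have [phi [dA cB fE]] := iso_on_viso fA fB fAB.
have := preim_index (vinv phi) fX; congr finite_index.
apply/seteqP; split=> y.
  move=> [/= cy Xy]; have [_ <-] := vinv_funP cy.
  by rewrite fE; apply: XY.
move=> /sYX[x Xx <-]; rewrite -fE; have dx : x \isin vdom phi by rewrite dA; apply: sXA.
by split=> /=; [apply: vfun_cod | rewrite vfunK].
Qed.

(** The orbit relation of [AComm F] on subgroups of finite index. *)
Definition AComm_equiv X Y : Prop :=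
  exists phi, [/\ vdom phi = X, vcod phi = Y & AComm F (comm_class phi)].

Lemma AComm_equiv_refl X : finite_index X -> AComm_equiv X X.
Proof.
move=> fX; have iX : iso_on X X idfun.
  by apply: iso_onP => // x Xx; exists x.
have [phi [dX cX _]] := iso_on_viso fX fX iX.
by exists phi; split=> //; apply: aut_AComm; rewrite dX.
Qed.

Lemma AComm_equiv_trans Y X Z :
  AComm_equiv X Y -> AComm_equiv Y Z -> AComm_equiv X Z.
Proof.
move=> [phi [<- cphi aphi]] [psi [dpsi <- apsi]].
have i1 := viso_iso_on phi; have i2 := viso_iso_on psi.
rewrite cphi -dpsi in i1.
have [chi [dchi cchi chiE]] :=
  iso_on_viso (vdom_index phi) (vcod_index psi) (iso_on_comp i1 i2).
exists chi; split=> //; rewrite (@comm_class_comp phi psi chi).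
  exact: (@subM _ AC).
by move=> x _ _; rewrite chiE.
Qed.

Lemma AComm_equiv_aut D X Y (h : F -> F) : finite_index D -> iso_on D D h ->
  X `<=` D -> finite_index X -> iso_on X Y h -> AComm_equiv X Y.
Proof.
move=> fD hD sXD fX hX.
have fY := image_finite_index fD fD hD sXD hX fX.
have [phi [dD cD phiE]] := iso_on_viso fD fD hD.
have [psi [dX cY psiE]] := iso_on_viso fX fY hX.
exists psi; split=> //; rewrite (@comm_class_restrict phi psi).
  by apply: aut_AComm; rewrite dD.
by move=> x _ _; rewrite phiE psiE.
Qed.

Definition rank_ge A n : Prop :=
  exists m (y : 'I_m -> F), free_on A y /\ (n <= m)%N.

(** The rank [m] of [A] and that of the kernel satisfy [m' = #|Q| (m - 1) + 1]. *)
Lemma rank_ge_kernel A n (Q : finGroupType) (f : F -> Q) N : (0 < n)%N ->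
  rank_ge A n -> epi_on A f -> is_kernel A f N -> rank_ge N n.
Proof.
move=> n0 [m [y [fy le]]] ef kN.
have [m' [z [fz cz]]] := schreier fy ef kN; exists m', z; split=> //.
have Q0 : (0 < #|Q|)%N by rewrite -cardsT cardG_gt0.
by move: cz; rewrite card_ord; nia.
Qed.

Lemma rank_ge_series A n s X : (0 < n)%N ->
  rank_ge A n -> series A s X -> rank_ge X n.
Proof.
move=> n0; elim: s A => [|S s IH] A rA /=; first by move=> <-.
by move=> [N [f ef kf]]; apply: IH; apply: rank_ge_kernel rA ef kf.
Qed.

(** Disjoint sets of basis elements are used to reach [S] and [T], so each of the maps
    is still onto on the kernel of the other one. *)
Lemma two_epis D n (S T : finGroupType) :
    rank_ge D n -> (#|S| + #|T| <= n)%N ->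
  exists (f : F -> S) (g : F -> T),
    [/\ hom_on D f, hom_on D g,
        forall q, exists2 a, a \isin D & f a = q /\ g a = 1 &
        forall q, exists2 a, a \isin D & f a = 1 /\ g a = q].
Proof.
move=> [m [y [[Dy _ uy] le]]] leST.
have lem : (#|{: S + T}| <= m)%N by rewrite card_sum (leq_trans leST).
pose j (z : S + T) : 'I_m := widen_ord lem (enum_rank z).
pose r i := [pick z | j z == i].
have rj z : r (j z) = Some z.
  rewrite /r; case: pickP => [z' /eqP/(congr1 val)/=/val_inj/enum_rank_inj->//|].
  by move=> /(_ z); rewrite eqxx.
have [f hf fE] := uy S (fun i => if r i is Some (inl q) then q else 1).
have [g hg gE] := uy T (fun i => if r i is Some (inr q) then q else 1).
exists f, g; split=> // q.
  by exists (y (j (inl q))); rewrite // fE gE rj.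
by exists (y (j (inr q))); rewrite // fE gE rj.
Qed.

Definition bounded n (s : seq FS) := all (fun S => (2 * #|FS_repr S| <= n)%N) s.

Lemma perm_bounded n s t : perm_eq s t -> bounded n s = bounded n t.
Proof. exact: perm_all. Qed.

Lemma series_ex n D s : (0 < n)%N -> rank_ge D n -> bounded n s ->
  exists Z, series D s Z.
Proof.
move=> n0; elim: s D => [|S s IH] D rD /=; first by exists D.
move=> /andP[bS bs].
have [||f [g [hf _ fS _]]] := @two_epis D n (FS_repr S) (FS_repr S) => //.
  by rewrite addnn -mul2n.
have ef : epi_on D f by split=> // q; have [a Da [fa _]] := fS q; exists a.
have [N kN] := kernel_ex hf.
have [Z sZ] := IH N (rank_ge_kernel n0 rD ef kN) bs.
by exists Z, N => //; exists f.
Qed.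

(** When the top factors agree, an automorphism of [D] makes the top terms agree.
    Otherwise, let [S] and [T] be the top factors: a subgroup [Z] of the kernel of a
    map onto [S * T] has a series starting with [S], [T] and one starting with [T],
    [S], and both of its series fall under the first case. *)
Theorem same_factors_AComm n D s t X Y : (0 < n)%N ->
  finite_index D -> rank_ge D n -> bounded n s -> perm_eq s t ->
  series D s X -> series D t Y -> AComm_equiv X Y.
Proof.
move=> n0; move: {2}(size s) (leqnn (size s)) => k.
elim: k D s t X Y => [|k IH] D [|S s] [|T t] X Y //= sk fD rD bs pst.
1-5: by [move=> <- <-; apply: AComm_equiv_refl | have := perm_size pst].
have same_top R u v X' Y' : (size u <= k)%N -> bounded n (R :: u) -> perm_eq u v ->
    series D (R :: u) X' -> series D (R :: v) Y' -> AComm_equiv X' Y'.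
  move=> szu /andP[bR bu] puv [N sN sX] [M sM sY].
  have [f ef kf] := sN; have [g eg kg] := sM.
  have [m [y [fy lem]]] := rD.
  have [|h hD hE] := aut_transitive fy (redundant_large _) ef eg.
    by rewrite card_ord (leq_trans bR).
  have [M' M'E hN] := iso_on_sub hD (step_sub sN).
  have eM : M' = M.
    have [_ [hcod _ hsur]] := hD.
    apply: subgroup_ext => z; rewrite M'E; split=> [[x /kf[Dx fx] <-]|/kg[Dz gz]].
      by apply/kg; split; [apply: hcod | rewrite hE].
    have [x Dx xz] := hsur _ Dz; exists x => //; apply/kf; split=> //.
    by rewrite -hE // xz.
  rewrite {}eM in hN.
  have sXN := series_sub sX.
  have [X1 X1E hX] := iso_on_sub hN sXN.
  have fX : finite_index X'.
    by apply: (@series_finite_index _ D (R :: u)) => //; exists N.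
  apply: (@AComm_equiv_trans X1).
    by apply: AComm_equiv_aut fD hD _ fX hX => x /sXN/(step_sub sN).
  apply: (IH M u v) => //.
  - exact: finite_index_ker eg.1 kg fD.
  - exact: rank_ge_kernel rD eg kg.
  - exact: series_iso hN hX sX.
move=> sX sY; have [eST|neST] := eqVneq S T.
  by rewrite -eST in pst sY; apply: (same_top S s t) => //; rewrite perm_cons in pst.
have Ts : T \in s.
  have := perm_mem pst T; rewrite !in_cons eqxx eq_sym (negPf neST) /=.
  by move->.
pose u := rem T s.
have ps : perm_eq s (T :: u) := perm_to_rem Ts.
have pt : perm_eq (S :: u) t.
  rewrite -(perm_cons T); apply: perm_trans pst.
  rewrite perm_sym; apply: (perm_trans (y := S :: T :: u)); first by rewrite perm_cons.
  by apply/seq.permP => P /=; rewrite addnCA.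
have bT : bounded n (T :: t) by rewrite -(perm_bounded n pst).
have [bS bs'] : (2 * #|FS_repr S| <= n)%N /\ bounded n s by apply/andP.
have [bT1 bt] : (2 * #|FS_repr T| <= n)%N /\ bounded n t by apply/andP.
have [|f [g [hf hg fS gT]]] := @two_epis D n (FS_repr S) (FS_repr T) rD; first lia.
have ef : epi_on D f by split=> // q; have [a Da []] := fS q; exists a.
have eg : epi_on D g by split=> // q; have [a Da []] := gT q; exists a.
have [N kN] := kernel_ex hf; have [M kM] := kernel_ex hg.
have sDN : step D N S by exists f.
have sDM : step D M T by exists g.
have sNI : step N (subgroupI N M) T.
  exists g.
    split; first by apply: sub_hom hg; apply: kernel_sub kN.
    by move=> q; have [a Da [fa ga]] := gT q; exists a => //; apply/kN.
  move=> z; split=> [[Nz /kM[]]//|[Nz gz]]; split=> //; apply/kM; split=> //.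
  by have [] := (kN z).1 Nz.
have sMI : step M (subgroupI N M) S.
  exists f.
    split; first by apply: sub_hom hf; apply: kernel_sub kM.
    by move=> q; have [a Da [fa ga]] := fS q; exists a => //; apply/kM.
  move=> z; split=> [[/kN[]]//|[Mz fz]]; split=> //; apply/kN; split=> //.
  by have [] := (kM z).1 Mz.
have rI : rank_ge (subgroupI N M) n.
  have [h eh kh] := sNI; apply: rank_ge_kernel eh kh => //.
  exact: rank_ge_kernel ef kN.
have [Z sZ] : exists Z, series (subgroupI N M) u Z.
  apply: series_ex rI _ => //; move: bs'; rewrite -/(bounded n s) (perm_bounded n ps).
  by case/andP.
apply: (@AComm_equiv_trans Z).
  apply: (same_top S s (T :: u)) => //.
  by exists N => //; exists (subgroupI N M).
apply: (same_top T (S :: u) t) => //.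
- by have := perm_size ps => /= <-.
- have bSu : bounded n (S :: u) by rewrite (perm_bounded n pt).
  exact/andP.
- by exists M => //; exists (subgroupI N M).
Qed.

End AComm.

(** * The kernel is contained in [AComm] *)

Section Kernel.
Local Open Scope group_scope.
Variable F : groupType.
Implicit Types (A B D N X Y : subgroup F) (S T P : FS) (phi psi chi : viso F).

Lemma exists_prime_factor n : exists P : FS,
  prime #|FS_repr P| /\ (n < #|FS_repr P|)%N.
Proof.
have [p ltnp pp] := prime_above n.
have p0 : (0 < p)%N := prime_gt0 pp.
have cp : #|'I_p.-1.+1| = p by rewrite card_ord prednK.
have sp : simple [set: 'I_p.-1.+1]%SET.
  apply/simpleP; split; first by rewrite trivg_card1 cardsT cp; case: eqP pp => // ->.
  move=> H _; have := cardSg (finset.subsetT H : H \subset [set: 'I_p.-1.+1]%G).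
  rewrite cardsT cp => /(primeP pp).2 /orP[|/eqP cH].
    by rewrite -trivg_card1 => /eqP; left.
  by right; apply/eqP; rewrite eqEcard finset.subsetT /= cardsT cp cH.
have [P [iP _]] := FS_cover sp; exists P.
suff -> : #|FS_repr P| = p by [].
by have /group_isoE/card_isog := iP; rewrite !cardsT cp.
Qed.

(** A top term [N] that [p] kills would make [P] a quotient of the top factor, which is
    too small. So [p] remains onto along the series, and translating by elements of
    [N] shows that [B :&: D] has the same image in the top factor as [B]. *)
Lemma series_prime_kernel B A D s P (p : F -> FS_repr P) :
    hom_on (full_subgroup F) p -> is_kernel (full_subgroup F) p D ->
    (forall S, S \in s -> (#|FS_repr S| < #|FS_repr P|)%N) ->
    epi_on B p -> series B s A ->
  epi_on A p /\ series (subgroupI B D) s (subgroupI A D).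
Proof.
move=> hp kD; elim: s B => [|S s IH] B ltP ep /=; first by move=> <-.
move=> [N [g eg kg] sA].
have sNB : N `<=` B := kernel_sub kg.
have eN : epi_on N p.
  have [triv|//] := simple_image ep (kernel_normal eg.1 kg).
  have [|h hE] := factor_hom eg ep.1.
    by move=> x Bx gx; apply: triv; apply/kg.
  have := ltP S (mem_head _ _); rewrite ltnNge => /negP[].
  rewrite -[#|FS_repr S|]/(#|{: FS_repr S}|) -(size_codom h).
  apply: leq_trans (card_size _); apply/eq_leq/esym/eq_card => q.
  by rewrite inE; apply/codomP; have [x Bx <-] := ep.2 q; exists (g x); rewrite hE.
have [eA sAD] := IH N (fun T Ts => ltP T (mem_behead (s := S :: s) Ts)) eN sA.
split=> //; exists (subgroupI N D) => //; exists g.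
  split=> [x y [Bx _] [By _]|q]; first exact: eg.1.
  have [a Ba ga] := eg.2 q; have [b Nb pb] := eN.2 (p a)^-1.
  have Bb := sNB _ Nb; have /kg[_ gb] := Nb.
  exists (a * b); last by rewrite eg.1// ga gb mulg1.
  split; first exact: subM.
  by apply/kD; split=> //; rewrite hp// pb mulgV.
move=> x; split=> [[/kg[Bx gx] Dx]//|[[Bx Dx] gx]].
by split=> //; apply/kg.
Qed.

(** Let [p] map [F] onto a group of large prime order, with kernel [D]. The
    high rank of [D] allows an element [psi] of [AComm] to carry [A :&: D] to
    [B :&: D]. In [A] the subgroups [A :&: D] and [phi @^-1` D] both have prime
    index, so some automorphism [h] of [A] maps the former to the latter, and
    [psi^-1 \o phi \o h] is an automorphism of [A :&: D]. *)
Theorem same_multiplicity_AComm n (x : 'I_n -> F) phi s t :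
    (2 <= n)%N -> free_on (full_subgroup F) x ->
    series (full_subgroup F) s (vdom phi) ->
    series (full_subgroup F) t (vcod phi) -> perm_eq s t ->
  AComm F (comm_class phi).
Proof.
move=> n2 fx sA sB pst; set A := vdom phi in sA *; set B := vcod phi in sB *.
have [b b0 bs] : exists2 b, (0 < b)%N & bounded b s.
  exists (\max_(S <- s) (2 * #|FS_repr S|)).+1%N => //.
  apply/allP => S Ss; apply: leqW.
  exact: (leq_bigmax_seq (F := fun S => 2 * #|FS_repr S|)%N).
have [P [pP ltP]] := exists_prime_factor b.
have [_ _ ux] := fx; have [q nq] := prime_nontrivial pP.
have [p hp pE] := ux _ (fun=> q).
have i0 : 'I_n := Ordinal (leq_trans (leqnSn 1) n2).
have ep : epi_on (full_subgroup F) p.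
  split=> // r; have [H HP] := image_group hp.
  apply/HP; apply: (prime_generated pP nq).
  by apply/HP; exists (x i0); rewrite // pE.
have [D kD] := kernel_ex hp.
have fF := finite_indexT F.
have fD : finite_index D := finite_index_ker hp kD fF.
have rD : rank_ge D b.
  have [m [y [fy cm]]] := schreier fx ep kD.
  (* [m = #|P| (n - 1) + 1 > b] because [n >= 2] *)
  exists m, y; split=> //; move: cm ltP n2; rewrite card_ord.
  move: #|FS_repr P| => c; nia.
have lt_s S : S \in s -> (#|FS_repr S| < #|FS_repr P|)%N.
  move=> /(allP bs) leS; apply: leq_ltn_trans ltP; apply: leq_trans leS.
  by rewrite leq_pmull.
have lt_t S : S \in t -> (#|FS_repr S| < #|FS_repr P|)%N.
  by rewrite -(perm_mem pst); apply: lt_s.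
have [epA sAD] := series_prime_kernel hp kD lt_s ep sA.
have [epB sBD] := series_prime_kernel hp kD lt_t ep sB.
have DT : subgroupI (full_subgroup F) D = D by apply: subgroupI_r.
rewrite !{}DT in sAD sBD.
have [psi [dpsi cpsi apsi]] := same_factors_AComm b0 fD rD bs pst sAD sBD.
have iphi := viso_iso_on phi; rewrite -/A -/B in iphi.
have [hphi [phiB _ phiS]] := iphi.
have epphi : epi_on A (p \o phi).
  split=> [y z Ay Az /=|r]; first by rewrite hphi// hp.
  have [y By <-] := epB.2 r; have [a Aa <-] := phiS _ By.
  by exists a.
have [m [y [fy le2]]] : rank_ge A 2.
  by apply: (rank_ge_series _ _ sA) => //; exists n, x.
have [|h ih hE] := aut_transitive fy (redundant_prime pP _) epA epphi.
  by rewrite card_ord.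
have [hh [hA _ hS]] := ih.
have fA : finite_index A := vdom_index phi.
have [alpha [dal cal alE]] := iso_on_viso fA fA ih.
have fAD : finite_index (subgroupI A D) by apply: finite_indexI.
have fBD : finite_index (subgroupI B D).
  by apply: finite_indexI => //; apply: vcod_index.
have iAD : iso_on (subgroupI A D) (subgroupI B D) (phi \o h).
  have ich := iso_on_comp ih iphi; have [hch [chB chI chS]] := ich.
  have sADA : subgroupI A D `<=` A by move=> z [].
  apply: iso_onP.
  - exact: sub_hom hch.
  - move=> a [Aa /kD[_ pa]]; split; first exact: chB.
    by apply/kD; split=> //; have := hE a Aa => /= ->.
  - move=> a [Aa _] e; apply: (iso_on_inj ich) => //; first exact: sub1.
    by rewrite e (hom1 hch).
  - move=> z [Bz /kD[_ pz]]; have [a Aa az] := chS _ Bz; exists a => //.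
    split=> //; apply/kD; split=> //.
    by rewrite -(hE a Aa) -pz -az.
have [chi [dchi cchi chiE]] := iso_on_viso fAD fBD iAD.
have ipsi := viso_iso_on psi; rewrite dpsi cpsi in ipsi.
have [psi' ipsi' [psiK psi'K]] := iso_on_inv ipsi.
have [theta [dth cth thE]] := iso_on_viso fAD fAD (iso_on_comp iAD ipsi').
have ech : comm_class chi = comm_class phi * comm_class alpha.
  by apply: comm_class_comp => z _ _; rewrite chiE alE.
have eth : comm_class chi = comm_class psi * comm_class theta.
  apply: comm_class_comp => z; rewrite dchi => Az _; rewrite chiE thE /= psi'K//.
  by have [_ [iB _ _]] := iAD; apply: iB.
have ath : AComm F (comm_class theta) by apply: aut_AComm; rewrite dth.
have aal : AComm F (comm_class alpha) by apply: aut_AComm; rewrite dal.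
rewrite -[comm_class phi](mulgK (comm_class alpha)) -ech eth.
pose AC := Subgroup (AComm_subgroup F).
by apply: (@subF _ AC) aal; apply: (@subM _ AC).
Qed.

End Kernel.

(** * The kernel in terms of composition series *)

Section Bridge.
Local Open Scope quotient_scope.
Local Open Scope group_scope.
Variable F : groupType.
Implicit Types (A B K L M N X : subgroup F) (S T : FS) (phi psi chi : viso F).

Lemma quotient_epi A N (nNA : normal_in N A) :
  exists f : F -> Defs.quotient_group nNA, epi_on A f /\ is_kernel A f N.
Proof.
pose Q := Defs.quotient_group nNA.
pose f x : Q := if pselect (x \isin A) is left Ax
  then \pi_Q (Sub x (mem_set Ax) : subgroup_type A) else 1.
have fE (u : subgroup_type A) : f (val u) = \pi_Q u.
  rewrite /f; case: pselect => [Au|[]]; last exact/set_mem/(valP u).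
  by congr (\pi_Q _); apply: val_inj.
have lift x : x \isin A -> exists u : subgroup_type A, val u = x.
  by move=> /mem_set Ax; exists (Sub x Ax).
have hf : hom_on A f.
  move=> x y /lift[u <-] /lift[v <-]; rewrite -valM !fE.
  by rewrite -[LHS]quot_mulE.
have f1 : f 1 = 1 by apply: hom1 hf.
exists f; split.
  split=> // q; have [u ->] := pi_ex q; exists (val u); last exact: fE.
  exact/set_mem/(valP u).
move=> x; split=> [Nx|[/lift[u <-]]].
  have Ax := nNA.1 _ Nx; have [u xu] := lift x Ax; split=> //.
  have <- : f (val (1 : subgroup_type A)) = 1 by rewrite monoid.val1.
  rewrite -xu !fE; apply/pi_quotP; rewrite monoid.val1 mulg1 xu.
  exact: subV.
have <- : f (val (1 : subgroup_type A)) = 1 by rewrite monoid.val1.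
by rewrite !fE => /pi_quotP; rewrite monoid.val1 mulg1 => /subV; rewrite invgK.
Qed.

Lemma group_iso_trans (K1 K2 K3 : groupType) :
  group_iso K1 K2 -> group_iso K2 K3 -> group_iso K1 K3.
Proof.
move=> [f bf] [g bg].
have gfM : {morph (g \o f) : x y / x * y} by move=> x y; rewrite /= !gmulfM.
pose hm := isMultiplicative.Build K1 K3 (g \o f) gfM.
pose h : {multiplicative K1 -> K3} := HB.pack (g \o f) hm.
by exists h; apply: bij_comp.
Qed.

Lemma quotient_iso_step A N S (nNA : normal_in N A) :
  group_iso (Defs.quotient_group nNA) (FS_repr S) <-> step A N S.
Proof.
have [f [ef kf]] := quotient_epi nNA; split=> [[h bh]|[g eg kg]].
  exists (fun x => h (f x)).
    split=> [x y Ax Ay|q]; first by rewrite ef.1// gmulfM.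
    have [h' hK h'K] := bh; have [a Aa fa] := ef.2 (h' q).
    by exists a; rewrite // fa h'K.
  move=> x; rewrite (propext (kf x)); split=> -[Ax e]; split=> //.
    by rewrite e multiplicative1.
  by apply: (bij_inj bh); rewrite e multiplicative1.
apply: (epi_group_iso ef eg) => x Ax; split=> e.
  by have /kg[] : x \isin N by apply/kf.
by have /kf[] : x \isin N by apply/kg.
Qed.

Lemma factor_iso_step A N S : factor_iso A N (FS_repr S) <-> step A N S.
Proof.
split=> [[nNA /quotient_iso_step//]|sN].
by exists (step_normal sN); apply/quotient_iso_step.
Qed.

Lemma composition_seriesP A l (C : nat -> subgroup F) :
    composition_series A l C ->
  exists2 s, series (full_subgroup F) s A &
    forall S, #|[set i : 'I_l | `[< factor_iso (C i) (C i.+1) (FS_repr S) >] ]%SET|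
              = count_mem S s.
Proof.
move=> [C0 Cl sC].
have /choice[sigma sP] : forall i, exists S : FS, (i < l)%N -> step (C i) (C i.+1) S.
  move=> i; have [lt|_] := boolP (i < l)%N; last first.
    by have [P _] := exists_prime_factor 0; exists P.
  have [nC [Q [sQ iQ]]] := sC i lt; have [S [iS _]] := FS_cover sQ.
  by exists S => _; apply/quotient_iso_step/(group_iso_trans iQ iS).
have sE i d : (i + d = l)%N -> series (C i) (map sigma (iota i d)) A.
  elim: d i => [|d IH] i /=; first by rewrite addn0 => ->.
  move=> e; exists (C i.+1); last by apply: IH; rewrite addSnnS.
  by apply: sP; rewrite -e addnS ltnS leq_addr.
exists (map sigma (iota 0 l)); first by rewrite -C0; apply: sE.
move=> S; rewrite cardsE cardE /enum_mem size_filter.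
rewrite [RHS]count_map -val_enum_ord [RHS]count_map enumT; apply: eq_count => i.
rewrite /= [LHS]/in_mem /=.
apply/asboolP/eqP => [/factor_iso_step sS|<-].
  exact: step_uniq (sP i (ltn_ord i)) sS.
exact/factor_iso_step/sP.
Qed.

Lemma series_composition A s : series (full_subgroup F) s A ->
  exists C, composition_series A (size s) C.
Proof.
move=> ss; suff [C [C0 Cl sC]] : exists C : nat -> subgroup F,
    [/\ C 0%N = full_subgroup F, C (size s) = A &
        forall i, (i < size s)%N -> exists S, step (C i) (C i.+1) S].
  exists C; split=> // i lti; have [S sS] := sC i lti; exists (step_normal sS).
  by exists (FS_repr S); split; [apply: FS_simple | apply/quotient_iso_step].
elim: s (full_subgroup F) ss => [|S s IH] B /=; first by move=> <-; exists (fun=> B).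
move=> [N sN /IH[C [C0 Cl sC]]]; exists (fun i => if i is j.+1 then C j else B).
by split=> // -[|i] lti /=; [exists S; rewrite C0 | apply: sC].
Qed.

Lemma factor_count_series A s S :
  series (full_subgroup F) s A -> factor_count A S = count_mem S s.
Proof.
move=> ss; have [C cC] := series_composition ss.
have cA : composition_series A (some_series A).1 (some_series A).2.
  apply: (xgetPex (0%N, fun=> A) (P := [set s | composition_series A s.1 s.2])).
  by exists (size s, C).
have [t st tE] := composition_seriesP cA.
rewrite [LHS]tE; have /seq.permP -> // := jordan_hoelder st ss.
Qed.

Lemma image_iso A B N X (f : F -> F) : iso_on A B f -> N `<=` A ->
  subgroup_set X = f @` N -> iso_on N X f.
Proof.
move=> ff sN e; have [M eM fM] := iso_on_sub ff sN.
by rewrite (_ : X = M)//; apply: subgroup_inj; rewrite e eM.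
Qed.

Lemma normal_inS A B N : normal_in N B -> N `<=` A -> A `<=` B -> normal_in N A.
Proof. by move=> [_ nN] sNA sAB; split=> // x y /sAB Ax; apply: nN. Qed.

Lemma viso_preimage phi M : M `<=` vcod phi -> finite_index M ->
  exists L, [/\ L `<=` vdom phi, finite_index L, iso_on L M phi &
    normal_in M (vcod phi) -> normal_in L (vdom phi)].
Proof.
move=> sM fM; exists (Subgroup (preim_subgroup phi M)).
have sL : Subgroup (preim_subgroup phi M) `<=` vdom phi by move=> x [].
split=> //; first exact: preim_index.
  have [hf _] := viso_iso_on phi; apply: iso_onP.
  - exact: sub_hom hf.
  - by move=> x [].
  - move=> x [Ax _] e; apply: (iso_on_inj (viso_iso_on phi)) => //.
      exact: sub1.
    by rewrite e vfun1.
  - move=> y My; have [x Ax xy] := vfun_surj (sM _ My).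
    by exists x; rewrite // -xy in My *.
move=> [_ nM]; split=> // x y Ax [Ay /= My]; split; first exact: subJ.
rewrite /preimage /= (homJ (viso_iso_on phi).1)//; apply: nM => //.
exact: vfun_cod.
Qed.

Lemma viso_image phi N : N `<=` vdom phi -> finite_index N ->
  exists M, [/\ M `<=` vcod phi, finite_index M & iso_on N M phi].
Proof.
move=> sN fN; have iphi := viso_iso_on phi.
have [M ME iM] := iso_on_sub iphi sN; exists M; split=> //.
  by rewrite ME => _ [x Nx <-]; apply/vfun_cod/sN.
exact: image_finite_index (vdom_index phi) (vcod_index phi) iphi sN iM fN.
Qed.

(** Let [N] be the normal core of the domain, and restrict the values of [phi] to the
    normal core [M] of [phi N]. The preimage of [M] is normal in the domain and lies
    in [N], so it is normal in [N]. *)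
Lemma subnormal_repr_ex (c : Comm F) :
  exists phi, subnormal_viso phi /\ comm_class phi = c.
Proof.
have [phi ->] := comm_class_ex c.
have [N [fN nN sN]] := normal_core (vdom_index phi).
have [N' [sN' fN' iN]] := viso_image sN fN.
have [M [fM nM sM]] := normal_core fN'.
have sMB : M `<=` vcod phi by move=> y /sM/sN'.
have [L [sL fL iL nL]] := viso_preimage sMB fM.
have sLN : L `<=` N.
  move=> x Lx; have [_ [LM _ _]] := iL; have [_ [_ _ NS]] := iN.
  have [y Ny e] := NS _ (sM _ (LM _ Lx)).
  by rewrite (iso_on_inj (viso_iso_on phi) (sL _ Lx) (sN _ Ny) (esym e)).
have {}nL : normal_in L N.
  exact: normal_inS (nL (normal_inS nM sMB (fun x _ => I))) sLN sN.
have [s ss] := normal_series nN fN; have [t st] := normal_series nL fL.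
have [u su] := normal_series nM fM.
have [psi [dpsi cpsi psiE]] := iso_on_viso fL fM iL.
exists psi; split.
  split; last by rewrite cpsi; apply: series_subnormal su.
  by rewrite dpsi; apply: series_subnormal (series_cat ss st).
by apply: comm_class_restrict => x _ _; rewrite psiE.
Qed.

(** Two isomorphisms in the same class agree on a normal subgroup [N] of [F]. The
    factors between [N] and the domain are those between [phi N] and the codomain,
    so the balance of factors can be read off on [N]. *)
Lemma balance_invariant phi psi s t s' t' :
    viso_agree phi psi ->
    series (full_subgroup F) s (vdom phi) -> series (full_subgroup F) t (vcod phi) ->
    series (full_subgroup F) s' (vdom psi) -> series (full_subgroup F) t' (vcod psi) ->
  forall S, (count_mem S s + count_mem S t' = count_mem S s' + count_mem S t)%N.
Proof.
move=> [C [fC C1 C2 eC]] ss st ss' st' S.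
have [N [fN nN sN]] := normal_core fC.
have s1 : N `<=` vdom phi by move=> x /sN/C1.
have s2 : N `<=` vdom psi by move=> x /sN/C2.
have [M [_ _ i1]] := viso_image s1 fN.
have i2 : iso_on N M psi.
  have [h1 [a1 b1 c1]] := i1; apply: iso_onP.
  - by apply: sub_hom (viso_iso_on psi).1.
  - by move=> x Nx; rewrite -eC; [exact: a1|exact: sN].
  - move=> x Nx e; apply: (iso_on_inj (viso_iso_on psi) (s2 _ Nx)); first exact: sub1.
    by rewrite e vfun1.
  - by move=> y /c1[x Nx <-]; exists x => //; rewrite eC//; apply: sN.
have [u su] := normal_series (normal_inS nN s1 (fun x _ => I)) fN.
have [v sv] := normal_series (normal_inS nN s2 (fun x _ => I)) fN.
have su' := series_iso (viso_iso_on phi) i1 su.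
have sv' := series_iso (viso_iso_on psi) i2 sv.
have /seq.permP/(_ (pred1 S)) := jordan_hoelder (series_cat ss su) (series_cat ss' sv).
have /seq.permP/(_ (pred1 S)) :=
  jordan_hoelder (series_cat st su') (series_cat st' sv').
rewrite !count_cat; lia.
Qed.

(** Any representative may serve as a witness, which eases the verification of the
    closure properties. *)
Definition balanced (c : Comm F) : Prop := exists phi s t,
  [/\ comm_class phi = c, series (full_subgroup F) s (vdom phi),
      series (full_subgroup F) t (vcod phi) & perm_eq s t].

Lemma dmap_eq0 (c : Comm F) : dmap c = 0%R <-> balanced c.
Proof.
have [sphi cphi] :
    subnormal_viso (subnormal_repr c) /\ comm_class (subnormal_repr c) = c.
  apply: (xgetPex (vid F) (P := [set phi | subnormal_viso phi /\ comm_class phi = c])).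
  exact: subnormal_repr_ex.
have [s ss] := subnormal_series sphi.1 (vdom_index _).
have [t st] := subnormal_series sphi.2 (vcod_index _).
have dE : dmap c = (\sum_(S <- undup (s ++ t))
    << (count_mem S t)%:Z - (count_mem S s)%:Z *g S >>)%R.
  rewrite /dmap; under eq_fsbigr do
    rewrite (factor_count_series _ ss) (factor_count_series _ st).
  rewrite (fsbigE (undup (s ++ t))) ?undup_uniq//.
    by apply: eq_bigl => S; rewrite in_setT.
  move=> S _.
  rewrite mem_undup mem_cat negb_or => /andP[Ss St].
  by rewrite (count_memPn Ss) (count_memPn St) GRing.subrr freegU0.
have {}dE : dmap c = 0%R <-> perm_eq s t.
  rewrite dE; split=> [e|/seq.permP p]; last first.
    by rewrite big1// => S _; rewrite p GRing.subrr freegU0.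
  apply/allP => S; rewrite -mem_undup => Sst; have := congr1 (coeff S) e.
  rewrite GRing.raddf_sum (bigD1_seq S) ?undup_uniq//= coeffU eqxx GRing.mulr1 coeff0.
  rewrite big1 ?GRing.addr0 => [/eqP|T /negPf TS]; last first.
    by rewrite coeffU TS GRing.mulr0.
  by rewrite GRing.subr_eq0 => /eqP[->].
split=> [/dE p|[phi [s' [t' [cp ss' st' /seq.permP p]]]]].
  by exists (subnormal_repr c), s, t.
apply/dE/allP => S _; have ag : viso_agree (subnormal_repr c) phi.
  by apply/comm_classP; rewrite cp.
have := balance_invariant ag ss st ss' st' S; rewrite (p (pred1 S)) /=.
by move=> e; apply/eqP; lia.
Qed.

(** To compose [psi] and [phi], restrict them so that they meet in a normal subgroup
    [N] of [F]. *)
Lemma balanced_subgroup : is_subgroup balanced.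
Proof.
apply/is_subgroupP; split.
  exists (vid F), [::], [::]; split=> //.
suff bM : forall c d, balanced c -> balanced d -> balanced (c * d).
  move=> c d bc [phi [s [t [cphi ss st pst]]]]; apply: bM => //.
  exists (vinv phi), t, s; split=> //; last by rewrite perm_sym.
  by rewrite -cphi [RHS]comm_invE.
move=> _ _ [phi [s [t [<- ss st pst]]]] [psi [s' [t' [<- ss' st' pst']]]].
have fI : finite_index (subgroupI (vcod psi) (vdom phi)).
  by apply: finite_indexI; [apply: vcod_index | apply: vdom_index].
have [N [fN nN sN]] := normal_core fI.
have s1 : N `<=` vcod psi by move=> x /sN[].
have s2 : N `<=` vdom phi by move=> x /sN[].
have [L [sL fL iL _]] := viso_preimage s1 fN.
have [M [sM fM iM]] := viso_image s2 fN.
have [u su] := normal_series (normal_inS nN s1 (fun x _ => I)) fN.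
have [v sv] := normal_series (normal_inS nN s2 (fun x _ => I)) fN.
have sv' := series_iso (viso_iso_on phi) iM sv.
have [g ig [gK Kg]] := iso_on_inv (viso_iso_on psi).
have igL : iso_on N L g.
  have [_ [LN _ NL]] := iL; apply: (image_iso ig s1); apply/seteqP; split.
    by move=> x Lx; exists (psi x); [apply: LN | apply/gK/sL].
  by move=> _ [_ /NL[x Lx <-] <-]; rewrite gK//; apply: sL.
have su' := series_iso ig igL su.
have [chi [dchi cchi chiE]] := iso_on_viso fL fM (iso_on_comp iL iM).
exists chi, (s' ++ u), (t ++ v); rewrite dchi cchi; split.
- by apply: comm_class_comp => x _ _; rewrite chiE.
- exact: series_cat ss' su'.
- exact: series_cat st sv'.
- apply: (perm_trans (y := t' ++ u)); first by rewrite perm_cat2r.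
  apply: perm_trans (jordan_hoelder (series_cat st' su) (series_cat ss sv)) _.
  by rewrite perm_cat2r.
Qed.

(** For an automorphism [phi] of [A] and a normal subgroup [N] of [F] in [A], put
    [K = phi N :&: N]. Its preimage [L] and [K] lie in [N], with the same factors in
    [A], hence also in [N]. *)
Lemma aut_balanced phi : vdom phi = vcod phi -> balanced (comm_class phi).
Proof.
move=> e; have [N [fN nN sN]] := normal_core (vdom_index phi).
have [M [sM fM iM]] := viso_image sN fN.
have nNA := normal_inS nN sN (fun x _ => I).
have [_ nM] : normal_in M (vcod phi).
  have [_ [NM _ MN]] := iM; split=> // x y /vfun_surj[a Aa <-] /MN[b Nb <-].
  rewrite -(homJ (viso_iso_on phi).1)//; last exact: sN.
  by apply: NM; apply: nNA.2.
pose K := subgroupI M N.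
have sK : K `<=` vcod phi by move=> x [/sM].
have fK : finite_index K by apply: finite_indexI.
have nK : normal_in K (vcod phi).
  split=> // x y Ax [My Ny]; split; first exact: nM.
  by apply: nNA.2; rewrite // e.
have [L [sL fL iL /(_ nK) nL]] := viso_preimage sK fK.
have sLN : L `<=` N.
  move=> x Lx; have [_ [LK _ _]] := iL; have [_ [_ _ NS]] := iM.
  have [y Ny eyx] := NS _ (LK _ Lx).1.
  by rewrite (iso_on_inj (viso_iso_on phi) (sL _ Lx) (sN _ Ny) (esym eyx)).
have sKN : K `<=` N by move=> x [].
have [r sr] := normal_series nN fN; have [a sa] := normal_series nNA fN.
have [u su] := normal_series (normal_inS nL sLN sN) fL.
rewrite -e in nK.
have [v sv] := normal_series (normal_inS nK sKN sN) fK.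
have sw := series_cat sa su; have sw' := series_iso (viso_iso_on phi) iL sw.
rewrite -e in sw'.
have := jordan_hoelder sw' (series_cat sa sv); rewrite perm_cat2l => puv.
have [chi [dchi cchi chiE]] := iso_on_viso fL fK iL.
exists chi, (r ++ u), (r ++ v); rewrite dchi cchi perm_cat2l; split=> //.
- by apply: comm_class_restrict => x _ _; rewrite chiE.
- exact: series_cat sr su.
- exact: series_cat sr sv.
Qed.

Lemma AComm_balanced : AComm F `<=` balanced.
Proof.
apply: smallest_sub; first exact: balanced_subgroup.
by move=> _ [A _ [phi [e1 e2] <-]]; apply: aut_balanced; rewrite e1 e2.
Qed.

End Bridge.

(** * The kernel is [AComm] *)

Theorem theorem3p7 (F : groupType) (n : nat)
    (n_ge2 : (2 <= n)%N) (F_free : free_of_rank F n) :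
  [set c : Comm F | dmap c = 0%R] = AComm F.
Proof.
have [x /free_basis_on fx] := F_free.
apply/seteqP; split=> [c /dmap_eq0[phi [s [t [<- ss st pst]]]]|c].
  exact: same_multiplicity_AComm n_ge2 fx ss st pst.
by move=> /AComm_balanced/dmap_eq0.
Qed.
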